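(* Let $\{X_t\}$ be an irreducible Markov chain on a finite state space $\Sigma$, let $i\in\Sigma$, $\epsilon,\alpha,\Delta\in(0,1)$, and run $\mathrm{IteratedRefinement}(i,\epsilon,\alpha)$. With probability greater than $1-\alpha$, the following three statements hold: (a) If $\hat\pi_i^{(k)}<\Delta/(1+\epsilon)$ for any $k$, then $\pi_i<\Delta$. (b) For all $k$ such that $\hat p^{(k)}<2\epsilon/3$, $$\left|\frac{\hat\pi_i^{(k)}-\pi_i}{\hat\pi_i^{(k)}}\right|\le\epsilon\left(2Z_{\max}(i)+1\right)\le\epsilon\left(4\ln(2)\,t_{\mathrm{mix}}+1\right).$$ (c) The number of random walk steps used by the algorithm before satisfying either $\hat\pi_i^{(k)}<\Delta/(1+\epsilon)$ or $\hat p^{(k)}<2\epsilon/3$ is bounded above by $$\tilde O\left(\frac{\ln(1/\alpha)}{\epsilon^2}\min\left(H_i,\frac1{\epsilon\Delta}\right)\right)=\tilde O\left(\frac{\ln(1/\alpha)}{\epsilon^2}\min\left(\frac{t_{\mathrm{mix}}}{\pi_i},\frac1{\epsilon\Delta}\right)\right).$$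
   Context: Chain: $\{X_t\}_{t\ge0}$ is a discrete-time Markov chain with transition matrix $P$ and unique stationary distribution $\pi$; $\mathbb P_i(\cdot)=\mathbb P(\cdot\mid X_0=i)$, $\mathbb E_i[\cdot]=\mathbb E[\cdot\mid X_0=i]$; $T_i=\inf\{t\ge1:X_t=i\}$. Mixing quantities (finite $\Sigma$): $H_i=\max_{j\in\Sigma}\mathbb E_j[T_i]$; the fundamental matrix is $Z=(I-P+\mathbf 1\pi^T)^{-1}$, also written $Z=\sum_{t\ge0}(P^t-\mathbf 1\pi^T)$; $Z_{\max}(i)=\max_{k\in\Sigma}|Z_{ki}|$; $t_{\mathrm{mix}}=\min\{t:\max_{x\in\Sigma}\|P^t(x,\cdot)-\pi\|_{TV}\le1/4\}$ with $\|\cdot\|_{TV}$ total variation distance. Algorithm $\mathrm{IteratedRefinement}(i,\epsilon,\alpha)$: iterations $k=1,2,\dots$ with truncation thresholds $\theta^{(k)}=2^k$ and sample sizes $N^{(1)}=\lceil 6(1+\epsilon)\ln(8/\alpha)/\epsilon^2\rceil$, $N^{(k+1)}=\lceil 3(1+\epsilon)\theta^{(k+1)}\ln(4\theta^{(k+1)}/\alpha)/(\hat T_i^{(k)}\epsilon^2)\rceil$. In iteration $k$, $N^{(k)}$ fresh independent realizations of the chain started at $X_0=i$ are simulated, each stopped at the first time $t\ge1$ with $t=\theta^{(k)}$ or $X_t=i$; the $s$-th has length $t_s$ distributed as $\min(T_i,\theta^{(k)})$. Set $\hat T_i^{(k)}=\frac1{N^{(k)}}\sum_{s=1}^{N^{(k)}}t_s$,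 $\hat\pi_i^{(k)}=1/\hat T_i^{(k)}$, and let $\hat p^{(k)}$ be the fraction of the $N^{(k)}$ samples that are truncated (those with $T_i>\theta^{(k)}$). The number of random walk steps in iteration $k$ is $N^{(k)}\hat T_i^{(k)}$. Notation: $\tilde O(f(a)g(b))=O(f(a)\,\mathrm{polylog} f(a))\,O(g(b)\,\mathrm{polylog} g(b))$; when two $\tilde O$-expressions are joined by ''$=$'', the right one is a further upper bound for the left one.
   Formalization: In (b) the second inequality takes Z as the series Σ(P^t−1π^T), as it fails for the inverse; the first is shown for both. t_mix is over t≥1, infinite for periodic chains. In (c) constants are uniform for α≤α₀ with any fixed α₀<1, as none work as α→1. *)

(* Defs.v *)
From HB Require Import structures.
From mathcomp Require Import all_boot all_order all_algebra.
From mathcomp Require Import all_classical all_reals all_analysis.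
Import Order.TTheory GRing.Theory Num.Theory.
Import numFieldNormedType.Exports.

Set Implicit Arguments.
Unset Strict Implicit.
Unset Printing Implicit Defensive.

Local Open Scope classical_set_scope.
Local Open Scope ring_scope.

(* The finite state space is 'I_n; P x y is the probability of moving from x
   to y, and distributions are row vectors. *)

Definition stochastic (R : realType) (n : nat) (P : 'M[R]_n) : Prop :=
  (forall x y, 0 <= P x y) /\ (forall x, \sum_y P x y = 1).

Definition irreducible (R : realType) (n : nat) (P : 'M[R]_n) : Prop :=
  forall x y, exists t : nat, 0 < (P ^+ t) x y.

Definition stationary (R : realType) (n : nat) (P : 'M[R]_n) (pi : 'rV[R]_n)
    : Prop :=
  [/\ forall x, 0 <= pi 0 x, \sum_x pi 0 x = 1 & pi *m P = pi].

(* A process is X : time -> Omega -> state. The last clause is the Markov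
   property, multiplied out so that it needs no division by the probability of
   the past. *)
Definition markov_chain (d : measure_display) (T : measurableType d)
    (R : realType) (n : nat) (Pr : probability T R) (P : 'M[R]_n) (i : 'I_n)
    (X : nat -> T -> 'I_n) : Prop :=
  [/\ forall t x, measurable [set w | X t w = x],
      Pr [set w | X 0%N w = i] = 1%E
    & forall (m : nat) (x : nat -> 'I_n),
        Pr [set w | forall s, (s <= m.+1)%N -> X s w = x s] =
        (Pr [set w | forall s, (s <= m)%N -> X s w = x s]
          * (P (x m) (x m.+1))%:E)%E].

Definition path_events (T : Type) (n : nat) (X : nat -> T -> 'I_n)
    : set (set T) :=
  <<s [set A | exists t x, A = [set w | X t w = x]] >>.

(* Mutual independence of the sigma-algebras generated by the processes. *)
Definition independent_processes (d : measure_display) (T : measurableType d)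
    (R : realType) (n : nat) (Pr : probability T R) (I : eqType)
    (X : I -> nat -> T -> 'I_n) : Prop :=
  forall (s : seq I) (A : I -> set T),
    uniq s -> (forall j, j \in s -> path_events (X j) (A j)) ->
    Pr (\big[setI/setT]_(j <- s) A j) = (\prod_(j <- s) Pr (A j))%E.

(* T_i = inf {t >= 1 : x_t = i}, which is +oo if the path never returns. *)
Definition hitting_time (R : realType) (n : nat) (i : 'I_n) (x : nat -> 'I_n)
    : \bar R :=
  ereal_inf [set t%:R%:E | t in [set t : nat | (1 <= t)%N /\ x t = i]].

(* H_i = max_j E_j[T_i], where Y j is a realization of the chain started
   at j. *)
Definition max_hitting_time (d : measure_display) (T : measurableType d)
    (R : realType) (n : nat) (Pr : probability T R)
    (Y : 'I_n -> nat -> T -> 'I_n) (i : 'I_n) : \bar R :=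
  \big[maxe/0%E]_(j < n) (\int[Pr]_w hitting_time R i (fun t => Y j t w))%E.

Definition tv_dist (R : realType) (n : nat) (p q : 'rV[R]_n) : R :=
  \big[Num.max/0]_(A : {set 'I_n}) `|\sum_(x in A) (p 0 x - q 0 x)|.

(* The minimum is over t >= 1 and is +oo when no such t exists, i.e. for
   periodic chains. Allowing t = 0 would only change the value for the chain
   with a single state, from 1 to 0. *)
Definition mixing_time (R : realType) (n : nat) (P : 'M[R]_n) (pi : 'rV[R]_n)
    : \bar R :=
  ereal_inf [set t%:R%:E | t in [set t : nat | (1 <= t)%N /\
    \big[Num.max/0]_(x < n) tv_dist (row x (P ^+ t)) pi <= 4^-1]].

(* The inverse and the series below, although both are called the fundamental
   matrix, are not equal: when the series converges, the inverse is its sum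
   plus 1 pi^T. *)
Definition fundamental_inv (R : realType) (n : nat) (P : 'M[R]_n)
    (pi : 'rV[R]_n) : 'M[R]_n :=
  invmx (1%:M - P + (const_mx 1 : 'cV[R]_n) *m pi).

Definition fundamental_series (R : realType) (n : nat) (P : 'M[R]_n)
    (pi : 'rV[R]_n) (Z : 'M[R]_n) : Prop :=
  forall x y, (fun m : nat => \sum_(0 <= t < m) ((P ^+ t) x y - pi 0 y))
                @ \oo --> Z x y.

Definition Zmax (R : realType) (n : nat) (Z : 'M[R]_n) (i : 'I_n) : R :=
  \big[Num.max/0]_(k < n) `|Z k i|.

(* In the algorithm, x k s t is the state at time t of the s-th walk of
   iteration k; iterations are numbered from 1, samples from 0. *)

Definition theta (k : nat) : nat := (2 ^ k)%N.

(* The first t >= 1 with t = th or x_t = i. *)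
Definition walk_length (n : nat) (i : 'I_n) (th : nat) (x : nat -> 'I_n)
    : nat :=
  head th [seq t <- iota 1 th | (t == th) || (x t == i)].

Definition avg_length (R : realType) (n : nat) (i : 'I_n) (th N : nat)
    (x : nat -> nat -> 'I_n) : R :=
  (\sum_(s < N) (walk_length i th (x s))%:R) / N%:R.

(* N^(k); the value at k = 0 is not used. The ceilings are of positive reals,
   so that the absolute value is only a cast from int to nat. *)
Fixpoint num_samples (R : realType) (n : nat) (i : 'I_n) (eps alpha : R)
    (x : nat -> nat -> nat -> 'I_n) (k : nat) : nat :=
  match k with
  | 0 => 0%N
  | k'.+1 =>
      if k' == 0%N then
        `| Num.ceil (6 * (1 + eps) * ln (8 / alpha) / eps ^+ 2) |%N
      else
        `| Num.ceil (3 * (1 + eps) * (theta k)%:R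
                       * ln (4 * (theta k)%:R / alpha)
             / (avg_length R i (theta k')
                  (num_samples i eps alpha x k') (x k') * eps ^+ 2)) |%N
  end.

Definition T_hat (R : realType) (n : nat) (i : 'I_n) (eps alpha : R)
    (x : nat -> nat -> nat -> 'I_n) (k : nat) : R :=
  avg_length R i (theta k) (num_samples i eps alpha x k) (x k).

Definition pi_hat (R : realType) (n : nat) (i : 'I_n) (eps alpha : R)
    (x : nat -> nat -> nat -> 'I_n) (k : nat) : R :=
  (T_hat i eps alpha x k)^-1.

Definition p_hat (R : realType) (n : nat) (i : 'I_n) (eps alpha : R)
    (x : nat -> nat -> nat -> 'I_n) (k : nat) : R :=
  (\sum_(s < num_samples i eps alpha x k)
      (((theta k)%:R%:E < hitting_time R i (x k s))%E : nat))%:R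
  / (num_samples i eps alpha x k)%:R.

Definition num_steps (R : realType) (n : nat) (i : 'I_n) (eps alpha : R)
    (x : nat -> nat -> nat -> 'I_n) (k : nat) : R :=
  (num_samples i eps alpha x k)%:R * T_hat i eps alpha x k.

Definition stopping_iteration (R : realType) (n : nat) (i : 'I_n)
    (eps alpha Delta : R) (x : nat -> nat -> nat -> 'I_n) (k : nat) : Prop :=
  pi_hat i eps alpha x k < Delta / (1 + eps) \/
  p_hat i eps alpha x k < 2 * eps / 3.

(* A representative C * (f polylog f) * (g polylog g) of the soft-O class of
   f g. The inner 1 + f keeps the logarithm nonnegative for f < 1, and the
   outer 1 keeps the polylogarithm away from 0. *)
Definition soft_O_bound (R : realType) (C : R) (c : nat) (f g : R) : R :=
  C * (f * (1 + ln (1 + f)) ^+ c) * (g * (1 + ln (1 + g)) ^+ c).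

(* Main.v *)
(** Let [mu_k = E_i [min (T_i, 2^k)]] and [p_k = P_i (T_i > 2^k)]. Conditionally on
    the earlier iterations, the sample size of iteration [k] is a constant, large
    enough for Chernoff bounds on the mean length and on the fraction of truncated
    samples; the failure probabilities [O (alpha / 2^k)] add up to less than
    [alpha]. Outside this failure event everything is deterministic.

    The vector [u x = E_x [T_i]] is [(Z i i - Z x i + [x = i]) / pi_i], so that
    [u = 1 + K u], where [K] is [P] with the column [i] removed. Iterating gives
    [1 - pi_i mu_k = pi_i (K^(2^k) u) i <= 2 Zmax p_k], whence (a) and (b).

    The mixing bound sums [P^t x i - pi_i] over blocks of length [tmix]: the
    oscillation halves from one block to the next.

    For (c), a run that does not stop at iteration [k] has [2^k <= 3 / (eps Delta)]
    because truncated samples have length [2^k], and [p_k > eps / 12], which forces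
    [2^k = O (H log (1 / eps))] because [K^m 1 <= 1/2] for [m >= 2 H]. The cost of
    iteration [k] is [O (2^k log (2^k / alpha) / eps^2)], dominated by the last one. *)
Require Import Defs.
From HB Require Import structures.
From mathcomp Require Import all_boot all_order all_algebra.
From mathcomp Require Import all_classical all_reals all_analysis.
From mathcomp Require Import measurable_realfun.
From mathcomp Require Import zify ring lra.
Import Order.TTheory GRing.Theory Num.Theory.
Import numFieldNormedType.Exports.
Local Open Scope classical_set_scope.
Local Open Scope ring_scope.

(** * Exponential and logarithmic bounds *)

(** The obstacle is that the sample size of an iteration depends on the previous estimate, so the
    averaged samples are not a fixed family. Prescribing all earlier rows of recorded lengths makes
    the size a constant and the conditioning event a finite intersection over distinct samples, to
    which the product rule for independent processes applies. That constant is known to be large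
    enough only when the previous estimate was good; each failure event therefore carries the
    goodness of the previous row, and an induction over the iterations recovers goodness everywhere.

    The inverse and the series called fundamental matrix differ by [1 pi^T]. Only differences within
    column [i] enter the mean hitting times, so the bias is bounded for any matrix [W] with those
    differences, which serves both.

    Statement (c) needs one failure event beyond those of (a) and (b): many observed truncations
    although truncation is unlikely. Its bound has room to spare, so the total failure probability
    stays at [13/16 alpha] and the final inequality is strict. *)

Section ExpBounds.
Variable R : realType.
Implicit Types (x y z e : R) (f df : R -> R).

(** The Taylor bounds below climb by this lemma: the derivative of each gap is the gap of the
    previous bound. *)
Lemma is_derive_nondecreasing_from0 f df :
  (forall x, is_derive x 1 f (df x)) -> f 0 = 0 ->
  (forall x, 0 <= x -> 0 <= df x) -> forall x, 0 <= x -> 0 <= f x.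
Proof.
move=> fdf f0 df0 x x0; rewrite -f0.
apply: (@ger0_derive1_ndecry _ f 0) => //.
- move=> y; rewrite in_itv/= andbT => /ltW y0.
  by rewrite derive1E (@derive_val _ _ _ _ _ _ _ (fdf y)) df0.
- apply: continuous_subspaceT => y.
  by apply: differentiable_continuous; apply/derivable1_diffP; case: (fdf y).
Qed.

Lemma expRN_le2 x : 0 <= x -> expR (- x) <= 1 - x + x ^+ 2 / 2.
Proof.
move=> x0; rewrite -subr_ge0.
pose f y : R := 1 - y + y ^+ 2 / 2 - expR (- y).
apply: (@is_derive_nondecreasing_from0 f (fun y => - 1 + y + expR (- y))) => //.
- move=> y; rewrite /f; apply: is_derive_eq.
  by rewrite /GRing.scale/=; field.
- by rewrite /f oppr0 expR0; field.
- by move=> y y0; have := expR_ge1Dx (- y); lra.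
Qed.

Lemma expRN_ge3 x : 0 <= x -> 1 - x + x ^+ 2 / 2 - x ^+ 3 / 6 <= expR (- x).
Proof.
move=> x0; rewrite -subr_ge0.
pose f y : R := expR (- y) - (1 - y + y ^+ 2 / 2 - y ^+ 3 / 6).
apply: (@is_derive_nondecreasing_from0 f
  (fun y => 1 - y + y ^+ 2 / 2 - expR (- y))) => //.
- move=> y; rewrite /f; apply: is_derive_eq.
  by rewrite /GRing.scale/=; field.
- by rewrite /f oppr0 expR0; field.
- by move=> y y0; have := @expRN_le2 y y0; lra.
Qed.

Lemma expRN_le4 x : 0 <= x ->
  expR (- x) <= 1 - x + x ^+ 2 / 2 - x ^+ 3 / 6 + x ^+ 4 / 24.
Proof.
move=> x0; rewrite -subr_ge0.
pose f y : R := 1 - y + y ^+ 2 / 2 - y ^+ 3 / 6 + y ^+ 4 / 24 - expR (- y).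
apply: (@is_derive_nondecreasing_from0 f
  (fun y => expR (- y) - (1 - y + y ^+ 2 / 2 - y ^+ 3 / 6))) => //.
- move=> y; rewrite /f; apply: is_derive_eq.
  by rewrite /GRing.scale/=; field.
- by rewrite /f oppr0 expR0; field.
- by move=> y y0; have := @expRN_ge3 y y0; lra.
Qed.

(** Multiplied by the cubic lower bound of [expR (- x)], the right side is still at least 1. The
    range covers the tilt [2 e / 3] with [e < 1]. *)
Lemma expR_le2 x : 0 <= x <= 2 / 3 -> expR x <= 1 + x + 3 / 4 * x ^+ 2.
Proof.
move=> /andP[x0 x1].
have := @expRN_ge3 x x0; have xp := expR_gt0 x.
rewrite -(ler_pM2l xp) -expRD subrr expR0 => h.
have h2 : 1 <= (1 + x + 3 / 4 * x ^+ 2) * (1 - x + x ^+ 2 / 2 - x ^+ 3 / 6).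
  rewrite -subr_ge0.
  have -> : (1 + x + 3 / 4 * x ^+ 2) * (1 - x + x ^+ 2 / 2 - x ^+ 3 / 6) - 1 =
    x ^+ 2 * (1/4 - 5/12 * x + 5/24 * x^+2 - 1/8 * x^+3) by field.
  by apply: mulr_ge0; [exact: sqr_ge0|nra].
have h3 : 0 < 1 - x + x ^+ 2 / 2 - x ^+ 3 / 6 by nra.
by rewrite -(ler_pM2r h3); apply: le_trans h2.
Qed.

(** The value is chosen so that [2 ln 2] dominates the constant [11/8] of the mixing bound. *)
Lemma ln2_ge : 11 / 16 <= ln 2 :> R.
Proof.
rewrite -ler_expR lnK ?posrE// -[leRHS]invrK.
rewrite -[leLHS]invrK -expRN lef_pV2 ?posrE ?expR_gt0 ?invr_gt0//.
(* At [11/16] the cubic bound falls just short of [1/2]; at half the argument its square exceeds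
   [1/2]. *)
have -> : - (11 / 16) = - (11 / 32) - (11 / 32) :> R by field.
rewrite expRD.
have : 354 / 500 <= expR (- (11/32)) :> R.
  by apply: le_trans (@expRN_ge3 _ _); lra.
by set y := expR _; nra.
Qed.

(* [s = ln (1 + e)] is optimal; [s = 2 e / 3] already gives [e ^ 2 / 3]. *)
Lemma upper_tail_exponent e : 0 < e < 1 ->
  expR (2 * e / 3) - 1 - 2 * e / 3 * (1 + e) <= - (e ^+ 2 / 3).
Proof. by move=> /andP[e0 e1]; have := @expR_le2 (2 * e / 3); nra. Qed.

(** Tilt and deviation are both [9/10 e], and the quadratic bound gives [81/200 e^2], which leaves
    room above [e^2 / 3]. *)
Lemma lower_tail_exponent e : 0 < e < 1 ->
  expR (- (9 / 10 * e)) - 1 + 9 / 10 * e * (1 - 9 / 10 * e) <= - (e ^+ 2 / 3).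
Proof. by move=> /andP[e0 e1]; have := @expRN_le2 (9 / 10 * e); nra. Qed.

(** The left side bounds the exponential moment, at tilt [- e], of an indicator of mean at least
    [e]. *)
Lemma truncation_tail_exponent e : 0 < e < 1 ->
  1 - e * (1 - expR (- e)) <= expR (- (5 / 6 * e ^+ 2)).
Proof.
move=> /andP[e0 e1].
apply: le_trans (@expRN_ge3 _ _); last by nra.
have h := @expRN_le4 e (ltW e0).
apply: (@le_trans _ _ (1 - e * (e - e ^+ 2 / 2 + e ^+ 3 / 6 - e ^+ 4 / 24))).
  by rewrite lerD2l lerN2 ler_pM2l//; lra.
rewrite -subr_ge0.
have -> : 1 - 5 / 6 * e ^+ 2 + (5 / 6 * e ^+ 2) ^+ 2 / 2 - (5 / 6 * e ^+ 2) ^+ 3 / 6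
   - (1 - e * (e - e ^+ 2 / 2 + e ^+ 3 / 6 - e ^+ 4 / 24)) =
  e ^+ 2 * (1 / 6 - e / 2 + 37/72 * e ^+ 2 - e ^+ 3 / 24 - 125/1296 * e ^+ 4).
  by field.
apply: mulr_ge0; first exact: sqr_ge0.
have h3 : e ^+ 3 <= e ^+ 2 by nra.
have h4 : e ^+ 4 <= e ^+ 2 by nra.
nra.
Qed.

Lemma bernoulli_ge (n : nat) x : 0 <= x -> 1 + n%:R * x <= (1 + x) ^+ n.
Proof.
move=> x0; elim: n => [|n ih]; first by rewrite expr0 mul0r addr0.
rewrite exprS -natr1; have : 0 <= n%:R :> R by [].
by nra.
Qed.

(** Pulls constant factors out of the polylogarithms. *)
Lemma ln1D_mul_le (n : nat) x : 0 <= x -> ln (1 + n%:R * x) <= n%:R * ln (1 + x).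
Proof.
move=> x0; have n0 : 0 <= n%:R :> R by [].
rewrite [leRHS]mulr_natl -lnXn ?ltr_wpDr// ler_ln ?posrE ?exprn_gt0 ?ltr_wpDr ?mulr_ge0//.
exact: bernoulli_ge.
Qed.

End ExpBounds.

(** * Hitting times and the fundamental matrix *)

Section TabooOperator.
Context {R : realType} {n : nat}.
Variables (P : 'M[R]_n) (i : 'I_n).
Hypothesis P_stoch : stochastic P.

Definition taboo_op (f : 'I_n -> R) (x : 'I_n) : R :=
  \sum_(y | y != i) P x y * f y.

(* [hit_tail t x] is [P_x (T_i > t)]. *)
Definition hit_tail (t : nat) : 'I_n -> R := iter t taboo_op (fun=> 1).

Arguments hit_tail : simpl never.

Lemma hit_tailS t x : hit_tail t.+1 x = taboo_op (hit_tail t) x.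
Proof. by []. Qed.

Lemma taboo_op_le (f g : 'I_n -> R) : (forall x, x != i -> f x <= g x) ->
  forall x, taboo_op f x <= taboo_op g x.
Proof.
by move=> fg x; apply: ler_sum => y yi; rewrite ler_wpM2l ?fg//; case: P_stoch.
Qed.

Lemma eq_taboo_op (f g : 'I_n -> R) : (forall x, x != i -> f x = g x) ->
  forall x, taboo_op f x = taboo_op g x.
Proof. by move=> fg x; apply: eq_bigr => y yi; rewrite fg. Qed.

Lemma taboo_op_scale (c : R) (f : 'I_n -> R) x :
  taboo_op (fun y => c * f y) x = c * taboo_op f x.
Proof. by rewrite /taboo_op mulr_sumr; apply: eq_bigr => y _; rewrite mulrCA. Qed.

Lemma taboo_opD (f g : 'I_n -> R) x :
  taboo_op (fun y => f y + g y) x = taboo_op f x + taboo_op g x.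
Proof. by rewrite /taboo_op -big_split; apply: eq_bigr => y _; rewrite mulrDr. Qed.

Lemma taboo_op1_le x : taboo_op (fun=> 1) x <= 1.
Proof.
case: P_stoch => P0 P1; rewrite -[leRHS](P1 x) /taboo_op big_mkcond.
by apply: ler_sum => y _; case: ifP; rewrite ?mulr1.
Qed.

Lemma iter_taboo_op_le t (f g : 'I_n -> R) : (forall x, f x <= g x) ->
  forall x, iter t taboo_op f x <= iter t taboo_op g x.
Proof. by move=> fg; elim: t => //= t ih x; apply: taboo_op_le => y _. Qed.

Lemma iter_taboo_op_scale t (c : R) (f : 'I_n -> R) x :
  iter t taboo_op (fun y => c * f y) x = c * iter t taboo_op f x.
Proof.
elim: t x => //= t ih x; rewrite -taboo_op_scale.
by apply: eq_taboo_op => y _.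
Qed.

Lemma hit_tailD s t x : hit_tail (s + t) x = iter s taboo_op (hit_tail t) x.
Proof. by rewrite /hit_tail iterD. Qed.

Lemma hit_tail_ge0 t x : 0 <= hit_tail t x.
Proof.
elim: t x => [|t ih] x; first exact: ler01.
by rewrite hit_tailS; apply: sumr_ge0 => y _; rewrite mulr_ge0//; case: P_stoch.
Qed.

Lemma hit_tail_leS t x : hit_tail t.+1 x <= hit_tail t x.
Proof.
rewrite -addn1 hit_tailD; apply: iter_taboo_op_le => y.
exact: taboo_op1_le.
Qed.

Lemma hit_tail_le s t x : (s <= t)%N -> hit_tail t x <= hit_tail s x.
Proof.
move=> /subnK <-; elim: (t - s)%N => // k ih.
by rewrite addSn; apply: le_trans ih; exact: hit_tail_leS.
Qed.

Lemma hit_tail_le1 t x : hit_tail t x <= 1.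
Proof. exact: (@hit_tail_le 0). Qed.

(** Wherever the chain stands after [m] steps without a hit, the next [m] steps halve the tail
    again. *)
Lemma hit_tail_halving (m l : nat) : (forall x, hit_tail m x <= 2^-1) ->
  forall x, hit_tail (l * m) x <= 2^-1 ^+ l.
Proof.
move=> hm; elim: l => [|l ih] x; first by rewrite expr0 hit_tail_le1.
rewrite mulSn hit_tailD exprSr.
apply: (@le_trans _ _ (iter m taboo_op (fun y => 2^-1 ^+ l * 1) x)).
  by apply: iter_taboo_op_le => y; rewrite mulr1.
by rewrite iter_taboo_op_scale ler_pM2l ?exprn_gt0 ?invr_gt0//; exact: hm.
Qed.

(* [mean_trunc th] is [E_i [min (T_i, th)]]. *)
Definition mean_trunc (th : nat) : R := \sum_(0 <= t < th) hit_tail t i.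

Lemma mean_trunc_ge1 th : (0 < th)%N -> 1 <= mean_trunc th.
Proof.
case: th => // th _; rewrite /mean_trunc big_nat_recl//= lerDl.
by apply: sumr_ge0 => t _; exact: hit_tail_ge0.
Qed.

Lemma mean_trunc_le s t : (s <= t)%N -> mean_trunc s <= mean_trunc t.
Proof.
move=> st; rewrite /mean_trunc (big_cat_nat (leq0n s) st) lerDl.
by apply: sumr_ge0 => j _; exact: hit_tail_ge0.
Qed.

(** Tails decrease, so the second half of the sum is at most the first. Hence consecutive estimates
    differ by a bounded factor on a good run. *)
Lemma mean_trunc_double th : mean_trunc (2 * th) <= 2 * mean_trunc th.
Proof.
rewrite /mean_trunc mul2n -addnn (big_cat_nat (leq0n th) (leq_addl th th)).
rewrite -{2}[th]add0n big_addn addnK mulr_natl mulr2n lerD2l.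
by apply: ler_sum => t _; apply: hit_tail_le; rewrite leq_addr.
Qed.

(** Markov's inequality for [T_i], obtained from the monotonicity of the tail. *)
Lemma partial_sum_hit_tail_le (H : R) (m : nat) x :
  \sum_(0 <= t < m) hit_tail t x <= H -> m%:R * hit_tail m x <= H.
Proof.
apply: le_trans; rewrite mulr_natl -[in leLHS](subn0 m) -sumr_const_nat.
rewrite subn0 !big_nat; apply: ler_sum => t /andP[_ tm]; apply: hit_tail_le; exact: ltnW.
Qed.

End TabooOperator.
Arguments hit_tail : simpl never.

(** * Harmonic functions, the Poisson equation and mean hitting times *)

Section FundamentalMatrix.
Context {R : realType} {n : nat}.
Variables (P : 'M[R]_n) (pi : 'rV[R]_n).
Hypotheses (P_stoch : stochastic P) (P_irr : irreducible P)
  (pi_stat : stationary P pi).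

Lemma stochastic_exp t : stochastic (P ^+ t).
Proof.
case: P_stoch => P0 P1; elim: t => [|t [ih0 ih1]].
  split=> [x y|x]; first by rewrite expr0 !mxE ler0n.
  rewrite (bigD1 x)//= expr0 !mxE eqxx big1 ?addr0// => y yx.
  by rewrite !mxE eq_sym (negbTE yx).
split=> [x y|x].
  by rewrite exprS -mulmxE !mxE sumr_ge0// => z _; rewrite mulr_ge0.
under eq_bigr do rewrite exprS -mulmxE !mxE.
rewrite exchange_big/= -[RHS](P1 x); apply: eq_bigr => z _.
by rewrite -mulr_sumr ih1 mulr1.
Qed.

Lemma stationary_exp t : pi *m P ^+ t = pi.
Proof.
case: pi_stat => _ _ piP; elim: t => [|t ih]; first by rewrite expr0 mulmx1.
by rewrite exprS -mulmxE mulmxA piP.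
Qed.

Lemma stationary_expE t y : \sum_x pi 0 x * (P ^+ t) x y = pi 0 y.
Proof. by rewrite -[in RHS](stationary_exp t) mxE. Qed.

Lemma stationary_gt0 y : 0 < pi 0 y.
Proof.
case: pi_stat => pi0 pi1 _.
have [x px] : exists x, 0 < pi 0 x.
  apply/existsP; rewrite -[X in is_true X]negbK negb_exists; apply/negP => /forallP h.
  move: pi1; rewrite big1 => [/eqP|x _]; first by rewrite eq_sym oner_eq0.
  by apply/eqP; rewrite eq_le pi0 andbT leNgt h.
have [t Pt] := P_irr x y.
rewrite -(stationary_expE t) (bigD1 x)//= ltr_pwDl ?mulr_gt0//.
by apply: sumr_ge0 => z _; rewrite mulr_ge0//; case: (stochastic_exp t).
Qed.

Lemma stationary_le1 y : pi 0 y <= 1.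
Proof.
case: pi_stat => pi0 pi1 _; rewrite -pi1 (bigD1 y)//= lerDl.
by apply: sumr_ge0.
Qed.

Definition avg (A : 'M[R]_n) (f : 'I_n -> R) (x : 'I_n) : R := \sum_y A x y * f y.

Lemma avg0 f x : avg (P ^+ 0) f x = f x.
Proof.
rewrite /avg (bigD1 x)//= expr0 !mxE eqxx mul1r big1 ?addr0// => y yx.
by rewrite !mxE eq_sym (negbTE yx) mul0r.
Qed.

Lemma avgM (A B : 'M[R]_n) f x : avg (A * B) f x = avg A (avg B f) x.
Proof.
rewrite /avg; under eq_bigr do rewrite -mulmxE mxE mulr_suml.
rewrite exchange_big/=; apply: eq_bigr => y _; rewrite mulr_sumr.
by apply: eq_bigr => z _; rewrite mulrA.
Qed.

Lemma avgD s t f x : avg (P ^+ (s + t)) f x = avg (P ^+ s) (avg (P ^+ t) f) x.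
Proof. by rewrite exprD avgM. Qed.

Lemma stationary_avg t f : \sum_x pi 0 x * avg (P ^+ t) f x = \sum_x pi 0 x * f x.
Proof.
under eq_bigr do rewrite /avg mulr_sumr.
rewrite exchange_big/=; apply: eq_bigr => y _.
by rewrite -(stationary_expE t y) mulr_suml; apply: eq_bigr => x _; rewrite mulrA.
Qed.

(** Maximum principle: at a maximiser [z] the nonnegative differences [f z - f w] have average 0
    under every [P ^+ t], and irreducibility reaches each state. *)
Lemma harmonic_constant (f : 'I_n -> R) :
  (forall x, avg P f x = f x) -> forall x y, f x = f y.
Proof.
move=> hf.
have hft t x : avg (P ^+ t) f x = f x.
  elim: t x => [|t ih] x; first exact: avg0.
  rewrite exprS avgM -[RHS]hf; apply: eq_bigr => y _.
  by rewrite ih.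
suff h x : forall y, f y = f [arg max_(z > x) f z]%O.
  by move=> x y; rewrite (h x x) (h x y).
case: arg_maxP => //= z _ zmax y.
have [t Pt] := P_irr z y.
have [Pt0 Pt1] := stochastic_exp t.
have h0 : \sum_w (P ^+ t) z w * (f z - f w) = 0.
  under eq_bigr do rewrite mulrBr.
  rewrite sumrB -mulr_suml Pt1 mul1r.
  by have := hft t z; rewrite /avg => ->; rewrite subrr.
have := @psumr_eq0P R _ _ (fun w => (P ^+ t) z w * (f z - f w)) _ h0 y isT.
rewrite /= => /(_ _)/eqP; rewrite mulf_eq0 gt_eqF//= subr_eq0.
move=> h; apply/esym/eqP; apply: h => w _.
by rewrite mulr_ge0// subr_ge0 zmax.
Qed.

Lemma stationary_mul_fundamental :
  pi *m (1%:M - P + (const_mx 1 : 'cV[R]_n) *m pi) = pi.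
Proof.
case: pi_stat => pi0 pi1 piP.
rewrite mulmxDr mulmxBr mulmx1 piP subrr add0r mulmxA.
suff -> : pi *m const_mx 1 = (1%:M : 'M[R]_1) by rewrite mul1mx.
apply/matrixP => a b; rewrite !ord1 !mxE eqxx -[RHS]pi1.
by apply: eq_bigr => x _; rewrite !mxE mulr1.
Qed.

(** Since [pi A = pi], a kernel vector [z] has [pi z = 0]. Then [P z = z], so [z] is constant, and
    its stationary mean forces it to be 0. *)
Lemma fundamental_unit : 1%:M - P + (const_mx 1 : 'cV[R]_n) *m pi \in unitmx.
Proof.
set A := _ + _.
rewrite -unitmx_tr -row_free_unit; apply: inj_row_free => v.
move=> /(congr1 (fun M => M^T)); rewrite trmx_mul trmxK trmx0.
set z := v^T => Az0.
have piA : pi *m A = pi by exact: stationary_mul_fundamental.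
have piz : pi *m z = 0 by rewrite -piA -mulmxA Az0 mulmx0.
have Pz : P *m z = z.
  move: Az0; rewrite mulmxDl -mulmxA piz mulmx0 addr0 mulmxBl mul1mx.
  by move/eqP; rewrite subr_eq0 => /eqP <-.
have zc := @harmonic_constant (fun x => z x 0) _.
have {}zc : forall x y, z x 0 = z y 0.
  by apply: zc => x; rewrite -[in RHS]Pz mxE.
have z0 x : z x 0 = 0.
  have : (pi *m z) 0 0 = 0 by rewrite piz mxE.
  rewrite mxE; under eq_bigr do rewrite (zc _ x).
  by rewrite -mulr_suml; case: pi_stat => _ -> _; rewrite mul1r.
by apply/rowP => x; have := z0 x; rewrite !mxE.
Qed.

Local Notation Z := (fundamental_inv P pi).

Lemma stationary_fundamental y : \sum_x pi 0 x * Z x y = pi 0 y.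
Proof.
have : pi *m Z = pi.
  by rewrite -[X in X *m _]stationary_mul_fundamental mulmxK// fundamental_unit.
by move/matrixP/(_ 0 y); rewrite mxE.
Qed.

(** The Poisson equation; [pi Z = pi] reduces the rank-one term to [pi 0 y]. *)
Lemma fundamental_eq x y :
  Z x y - avg P (Z^~ y) x = (x == y)%:R - pi 0 y.
Proof.
have := mulmxV fundamental_unit; rewrite -/(fundamental_inv P pi).
rewrite mulmxDl mulmxBl mul1mx -mulmxA => /matrixP/(_ x y).
rewrite !mxE big_ord1 !mxE mul1r stationary_fundamental.
by move=> /eqP; rewrite eq_sym -subr_eq => /eqP <-.
Qed.

Section ReturnTime.
Variable i : 'I_n.

(* [mean_hit x] is [E_x [T_i]], in closed form through the fundamental matrix. *)
Definition mean_hit (x : 'I_n) : R :=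
  (Z i i - Z x i + (x == i)%:R) / pi 0 i.

(** The first-step equation, read off from the Poisson equation for column [i]. *)
Lemma mean_hit_eq x : mean_hit x = 1 + taboo_op P i mean_hit x.
Proof.
have pi0 := stationary_gt0 i; case: P_stoch => P0 P1.
have -> : taboo_op P i mean_hit x = \sum_y P x y * ((Z i i - Z y i) / pi 0 i).
  rewrite /taboo_op [RHS](bigD1 i)//= subrr mul0r mulr0 add0r.
  by apply: eq_bigr => y yi; rewrite /mean_hit (negbTE yi) addr0.
have -> : \sum_y P x y * ((Z i i - Z y i) / pi 0 i) =
   (Z i i - avg P (Z^~ i) x) / pi 0 i.
  rewrite /avg -[X in (X - _) / _]mul1r -(P1 x) mulr_suml -sumrB mulr_suml.
  by apply: eq_bigr => y _; rewrite -mulrBr mulrA.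
have -> : avg P (Z^~ i) x = Z x i - (x == i)%:R + pi 0 i.
  by have := fundamental_eq x i => /eqP; rewrite subr_eq => /eqP ->; ring.
by rewrite /mean_hit; field; rewrite gt_eqF.
Qed.

Lemma mean_hit_iter m x :
  mean_hit x = \sum_(0 <= t < m) hit_tail P i t x + iter m (taboo_op P i) mean_hit x.
Proof.
elim: m x => [|m ih] x; first by rewrite big_geq// add0r.
rewrite mean_hit_eq (@eq_taboo_op _ _ P i _ _ (fun y _ => ih y)).
rewrite taboo_opD big_nat_recl//= addrA; congr (1 + _ + _).
under [RHS]eq_bigr do rewrite hit_tailS /taboo_op.
rewrite exchange_big/= /taboo_op; apply: eq_bigr => y _.
by rewrite mulr_sumr.
Qed.

(** Minimum principle: a negative minimum [u z] would satisfy [u z >= 1 + u z], because the rows of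
    the taboo operator sum to at most 1. Nonnegativity lets the remainder in [mean_hit_iter] be
    dropped. *)
Lemma mean_hit_ge0 x : 0 <= mean_hit x.
Proof.
suff h : 0 <= mean_hit [arg min_(z < x) mean_hit z]%O.
  by apply: le_trans h _; case: arg_minP => // z _; exact.
case: arg_minP => //= z _ zmin; rewrite leNgt; apply/negP => z0.
have : mean_hit z * taboo_op P i (fun=> 1) z <= taboo_op P i mean_hit z.
  by rewrite -taboo_op_scale; apply: taboo_op_le => // y _; rewrite mulr1 zmin.
have := @taboo_op1_le _ _ P i P_stoch z.
have : 0 <= taboo_op P i (fun=> 1) z := hit_tail_ge0 P i P_stoch 1 z.
have := mean_hit_eq z; nra.
Qed.

Lemma sum_hit_tail_le m x : \sum_(0 <= t < m) hit_tail P i t x <= mean_hit x.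
Proof.
rewrite (mean_hit_iter m) lerDl.
rewrite -[leLHS](mul0r (hit_tail P i m x)) -iter_taboo_op_scale.
by apply: iter_taboo_op_le => // y; rewrite mul0r mean_hit_ge0.
Qed.

(** Kac's formula. *)
Lemma mean_hit_return : mean_hit i = (pi 0 i)^-1.
Proof. by rewrite /mean_hit subrr add0r eqxx mul1r. Qed.

Lemma mean_trunc_stationary_le1 th : pi 0 i * mean_trunc P i th <= 1.
Proof.
have pi0 := stationary_gt0 i.
by rewrite -ler_pdivlMl// mulr1 -mean_hit_return; exact: sum_hit_tail_le.
Qed.

Lemma Zmax_ge (W : 'M[R]_n) x : `|W x i| <= Zmax W i.
Proof. exact: (@le_bigmax _ _ _ _ (fun k => `|W k i|)). Qed.

(** Stated for every [W] with the same differences in column [i], so that it covers both the inverse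
    and the sum of the series. *)
Lemma mean_hit_le_Zmax (W : 'M[R]_n) :
  (forall x y, W x i - W y i = Z x i - Z y i) ->
  forall x, x != i -> mean_hit x <= 2 * Zmax W i / pi 0 i.
Proof.
move=> WZ x xi; have pi0 := stationary_gt0 i.
rewrite /mean_hit (negbTE xi) addr0 ler_pM2r ?invr_gt0// -WZ.
have := Zmax_ge W i; have := Zmax_ge W x.
by rewrite !ler_norml; lra.
Qed.

Lemma mean_trunc_bias (W : 'M[R]_n) th : (0 < th)%N ->
  (forall x y, W x i - W y i = Z x i - Z y i) ->
  1 - pi 0 i * mean_trunc P i th <= 2 * Zmax W i * hit_tail P i th i.
Proof.
move=> th0 WZ; have pi0 := stationary_gt0 i.
have := mean_hit_iter th i; rewrite mean_hit_return -/(mean_trunc P i th) => E.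
have {E} : 1 = pi 0 i * mean_trunc P i th + pi 0 i * iter th (taboo_op P i) mean_hit i.
  by rewrite -mulrDr -E mulfV ?gt_eqF.
suff : pi 0 i * iter th (taboo_op P i) mean_hit i <= 2 * Zmax W i * hit_tail P i th i by lra.
rewrite -ler_pdivlMl// mulrA [X in X * hit_tail _ _ _ _]mulrC.
(* As [th] is positive, the innermost application of the operator discards the value at [i], the one
   state that [mean_hit_le_Zmax] does not cover. *)
rewrite -iter_taboo_op_scale; case: th th0 => // th _.
rewrite !iterSr; apply: iter_taboo_op_le => // x.
by apply: taboo_op_le => // y yi; rewrite mulr1; exact: mean_hit_le_Zmax.
Qed.

End ReturnTime.

End FundamentalMatrix.

(** * Mixing time and the series for the fundamental matrix *)

(** As [v] has total mass 0, [f] may be shifted to have minimum 0. The sum is then at most [o] times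
    the mass of the positive part of [v], which is the value of [v] on an event. *)
Lemma signed_sum_le {R : realType} {I : finType} (v f : I -> R) (o b : R) (x0 : I) :
  \sum_x v x = 0 -> (forall A : {set I}, \sum_(x in A) v x <= b) ->
  (forall x y, f x - f y <= o) -> \sum_x v x * f x <= b * o.
Proof.
move=> v0 vb fo; have o0 : 0 <= o by rewrite -(subrr (f x0)).
set z := [arg min_(z < x0) f z]%O.
have zmin x : f z <= f x by rewrite /z; case: arg_minP => // w _; exact.
have -> : \sum_x v x * f x = \sum_x v x * (f x - f z).
  by under [RHS]eq_bigr do rewrite mulrBr; rewrite sumrB -mulr_suml v0 mul0r subr0.
apply: (@le_trans _ _ (\sum_(x in finset (fun x => 0 < v x)) v x * o)); last first.
  by rewrite -mulr_suml ler_wpM2r//; exact: vb.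
rewrite [leRHS]big_mkcond; apply: ler_sum => x _; rewrite inE.
have [vx|vx] := ltP 0 (v x); first by rewrite ler_pM2l.
by rewrite mulr_le0_ge0// subr_ge0.
Qed.

Lemma sum_block_le {R : realType} (g : nat -> R) (a m : nat) (c : R) :
  (forall r, g (a + r)%N <= c) ->
  \sum_(0 <= t < a + m) g t <= \sum_(0 <= t < a) g t + m%:R * c.
Proof.
move=> gc; rewrite (big_cat_nat (leq0n a) (leq_addr m a)) lerD2l/=.
rewrite -{1}[a]add0n big_addn addKn mulr_natl -[in leRHS](subn0 m) -sumr_const_nat.
by apply: ler_sum => r _; rewrite addnC gc.
Qed.

(* Splitting time into blocks of length [m] gives [c + 1/4 + o/4 + o/8 + ...]
   per unit of [m]. *)
Lemma sum_blocks_le {R : realType} (g : nat -> R) (m L : nat) (c o : R) : 0 <= o ->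
  (forall t, g t <= c) -> (forall r, g (m + r)%N <= 1 / 4) ->
  (forall l r, g (l.+2 * m + r)%N <= o * 2^-1 ^+ l / 4) ->
  \sum_(0 <= t < L.+2 * m) g t <= m%:R * (c + 1 / 4 + o / 2).
Proof.
move=> o0 gc g1 g2.
suff : \sum_(0 <= t < L.+2 * m) g t <= m%:R * (c + 1 / 4 + o / 2 * (1 - 2^-1 ^+ L)).
  move=> /le_trans; apply; rewrite ler_wpM2l// lerD2l ler_piMr ?divr_ge0// gerBl exprn_ge0//.
elim: L => [|L ih].
  rewrite expr0 subrr mulr0 addr0 mulSn mul1n.
  have := @sum_block_le _ g m m _ g1.
  have := @sum_block_le _ g 0 m _ gc; rewrite add0n (@big_geq _ _ _ 0 0)// add0r; lra.
have := @sum_block_le _ g _ m _ (g2 L); rewrite -mulSnr => /le_trans; apply.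
rewrite exprS; move: ih; set S := \sum_(_ <= _ < _) _; set h := 2^-1 ^+ L => ih.
suff : m%:R * (c + 1 / 4 + o / 2 * (1 - h)) + m%:R * (o * h / 4) <=
  m%:R * (c + 1 / 4 + o / 2 * (1 - 2^-1 * h)) by lra.
by rewrite -mulrDr le_eqVlt; apply/orP; left; apply/eqP; field.
Qed.

Section Mixing.
Context {R : realType} {n : nat}.
Variables (P : 'M[R]_n) (pi : 'rV[R]_n) (m : nat).
Hypotheses (P_stoch : stochastic P) (P_irr : irreducible P)
  (pi_stat : stationary P pi) (m_gt0 : (0 < m)%N)
  (m_mix : \big[Num.max/0]_(x < n) tv_dist (row x (P ^+ m)) pi <= 4^-1).
Implicit Types (f g : 'I_n -> R).

Local Notation Pt t := (avg (P ^+ t)).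

Lemma mix_event x (A : {set 'I_n}) : `|\sum_(y in A) ((P ^+ m) x y - pi 0 y)| <= 4^-1.
Proof.
apply: le_trans m_mix; apply: le_trans (le_bigmax _ _ x).
rewrite /tv_dist; apply: le_trans (le_bigmax _ _ A).
by rewrite le_eqVlt; apply/orP; left; apply/eqP; congr (`|_|); apply: eq_bigr => y _;
  rewrite mxE.
Qed.

Lemma avg_ge t (c : R) f : (forall x, c <= f x) -> forall x, c <= Pt t f x.
Proof.
move=> cf x; have [P0 P1] := stochastic_exp P P_stoch t.
by rewrite -[c]mul1r -(P1 x) mulr_suml; apply: ler_sum => y _; rewrite ler_wpM2l.
Qed.

Lemma avg_le t (c : R) f : (forall x, f x <= c) -> forall x, Pt t f x <= c.
Proof.
move=> cf x; have [P0 P1] := stochastic_exp P P_stoch t.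
by rewrite -[c]mul1r -(P1 x) mulr_suml; apply: ler_sum => y _; rewrite ler_wpM2l.
Qed.

Lemma avgN t f x : Pt t (fun y => - f y) x = - Pt t f x.
Proof. by rewrite /avg -sumrN; apply: eq_bigr => y _; rewrite mulrN. Qed.

Lemma avgB t f g x : Pt t (fun y => f y - g y) x = Pt t f x - Pt t g x.
Proof. by rewrite /avg -sumrB; apply: eq_bigr => y _; rewrite mulrBr. Qed.

Lemma avg_dev_le (o : R) f : (forall x y, f x - f y <= o) ->
  forall x, Pt m f x - \sum_y pi 0 y * f y <= o / 4.
Proof.
move=> fo x; have [_ pi1 _] := pi_stat; have [_ P1] := stochastic_exp P P_stoch m.
rewrite -sumrB; under eq_bigr do rewrite -mulrBl.
rewrite mulrC; apply: (@signed_sum_le _ _ _ f o 4^-1 x) => //.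
  by rewrite sumrB P1 pi1 subrr.
by move=> A; apply: le_trans (mix_event x A); exact: ler_norm.
Qed.

(** Two one-sided deviations of [o / 4] from the stationary mean, the lower one through [- f]. *)
Lemma avg_osc_le (o : R) f : (forall x y, f x - f y <= o) ->
  forall x y, Pt m f x - Pt m f y <= o / 2.
Proof.
move=> fo x y; have h1 := avg_dev_le o f fo x.
have : Pt m (fun y => - f y) y - \sum_z pi 0 z * - f z <= o / 4.
  by apply: avg_dev_le => a b; have := fo b a; lra.
rewrite avgN; under eq_bigr do rewrite mulrN.
by rewrite sumrN; lra.
Qed.

Lemma avg_osc_iter (o : R) f l r : (forall x y, Pt r f x - Pt r f y <= o) ->
  forall x y, Pt (l * m + r) f x - Pt (l * m + r) f y <= o * 2^-1 ^+ l.
Proof.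
move=> fo; elim: l => [|l ih] x y; first by rewrite expr0 mulr1 fo.
rewrite mulSn -addnA !avgD; have := avg_osc_le _ _ ih x y.
by move/le_trans; apply; rewrite exprSr mulrA.
Qed.

Definition centered f := \sum_y pi 0 y * f y = 0.

(** For a centered function the last block is compared with the mean 0 and gains a factor [1/4]
    instead of [1/2]. *)
Lemma avg_norm_le (o : R) f r : centered f -> (forall x y, Pt r f x - Pt r f y <= o) ->
  forall x, `|Pt (m + r) f x| <= o / 4.
Proof.
move=> f0 fo x; have cf : \sum_y pi 0 y * Pt r f y = 0 by rewrite stationary_avg.
rewrite ler_norml avgD; apply/andP; split.
  have := avg_dev_le o (fun y => - Pt r f y) _ x.
  rewrite avgN; under eq_bigr do rewrite mulrN.
  rewrite sumrN cf => h; suff : - Pt m (Pt r f) x - - 0 <= o / 4 by lra.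
  by apply: h => a b; have := fo b a; lra.
by have := avg_dev_le o _ fo x; rewrite cf subr0.
Qed.

Lemma centered_norm_le (o : R) f : centered f -> (forall x y, f x - f y <= o) ->
  forall x, `|f x| <= o.
Proof.
move=> f0 fo x; have [pi0 pi1 _] := pi_stat.
have E : f x = \sum_y pi 0 y * (f x - f y).
  by under eq_bigr do rewrite mulrBr; rewrite sumrB f0 -mulr_suml pi1 mul1r subr0.
rewrite E; apply: le_trans (ler_norm_sum _ _ _) _.
rewrite -[leRHS]mul1r -pi1 mulr_suml; apply: ler_sum => y _.
rewrite normrM ger0_norm// ler_wpM2l// ler_norml.
by have := fo x y; have := fo y x; lra.
Qed.

Lemma avg_decay (o : R) f t : centered f -> (forall x y, f x - f y <= o) ->
  forall x, `|Pt t f x| <= o * 2^-1 ^+ (t %/ m).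
Proof.
move=> f0 fo; apply: centered_norm_le; first by rewrite /centered stationary_avg.
rewrite {1 2}(divn_eq t m); apply: avg_osc_iter => x y.
set r := (t %% m)%N.
have {}fo a b : f a <= f b + o by have := fo a b; lra.
have h1 b : Pt r f x <= f b + o by apply: avg_le => a; exact: fo.
have : Pt r f x - o <= Pt r f y by apply: avg_ge => b; have := h1 b; lra.
lra.
Qed.

Lemma avg_cvg0 f : centered f -> forall x, (fun t => Pt t f x) @ \oo --> (0 : R).
Proof.
move=> f0 x.
pose o := \big[Num.max/0]_(x : 'I_n * 'I_n) (f x.1 - f x.2).
have fo a b : f a - f b <= o.
  exact: (@le_bigmax _ _ _ _ (fun x : 'I_n * 'I_n => f x.1 - f x.2) (a, b)).
have o0 : 0 <= o by rewrite -(subrr (f x)).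
(* Geometric decay is weakened to a harmonic rate: [2 ^ (t %/ m) > t %/ m] gives
   [2 ^ (t %/ m) * m >= t + 1]. *)
have bnd t : `|Pt t f x| <= (o * m%:R) * harmonic t.
  apply: le_trans (avg_decay o f t f0 fo x) _; rewrite /harmonic/= -mulrA ler_wpM2l//.
  rewrite exprVn -[leRHS]invrK lef_pV2 ?posrE ?exprn_gt0 ?invr_gt0 ?mulr_gt0 ?invr_gt0 ?ltr0n//.
  rewrite invfM invrK mulrC ler_pdivrMr ?ltr0n// -natrX -natrM ler_nat.
  have := ltn_expl (t %/ m) (isT : 1 < 2)%N.
  by rewrite -ltn_divLR// => h; rewrite -ltn_divLR//.
have lim : (fun t => (o * m%:R) * @harmonic R t) @ \oo --> (0 : R).
  by rewrite -[X in _ --> X](mulr0 (o * m%:R)); apply: cvgMr; exact: cvg_harmonic.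
apply/cvgr0Pnorm_le => e e0; move/cvgr0Pnorm_le: lim => /(_ e e0) [N _ hN].
exists N => // t /hN /= h; apply: le_trans (bnd t) _.
by apply: le_trans h; exact: ler_norm.
Qed.

Local Notation Z := (fundamental_inv P pi).
(** The correction by [1 pi^T] centers every column, as it must for the sum of a series of centered
    columns. *)
Definition fundamental_sum : 'M[R]_n := \matrix_(x, y) (Z x y - pi 0 y).

Lemma centered_fundamental y : centered (fun x => Z x y - pi 0 y).
Proof.
have [_ pi1 _] := pi_stat.
rewrite /centered; under eq_bigr do rewrite mulrBr.
by rewrite sumrB -mulr_suml pi1 mul1r stationary_fundamental// subrr.
Qed.

Lemma centered_indicator y : centered (fun x => (x == y)%:R - pi 0 y).
Proof.
have [_ pi1 _] := pi_stat.
rewrite /centered; under eq_bigr do rewrite mulrBr.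
rewrite sumrB -mulr_suml pi1 mul1r (bigD1 y)//= eqxx mulr1 big1 ?addr0 ?subrr//.
by move=> x /negbTE ->; rewrite mulr0.
Qed.

Lemma avg_const t (c : R) x : Pt t (fun=> c) x = c.
Proof.
have [_ P1] := stochastic_exp P P_stoch t.
by rewrite /avg -mulr_suml P1 mul1r.
Qed.

Lemma avg_indicator t x y : Pt t (fun z => (z == y)%:R - pi 0 y) x = (P ^+ t) x y - pi 0 y.
Proof.
rewrite avgB avg_const; congr (_ - _).
rewrite /avg (bigD1 y)//= eqxx mulr1 big1 ?addr0// => z /negbTE ->.
by rewrite mulr0.
Qed.

(** The sum telescopes, since the Poisson equation writes each centered indicator as [I - P] applied
    to a centered column of [Z]. *)
Lemma partial_sum_fundamental M x y :
  \sum_(0 <= t < M) ((P ^+ t) x y - pi 0 y) =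
  fundamental_sum x y - Pt M (fun z => Z z y - pi 0 y) x.
Proof.
rewrite mxE; elim: M => [|M ih]; first by rewrite big_geq// avg0 subrr.
rewrite big_nat_recr//= ih -avg_indicator exprSr avgM.
suff -> : Pt M (fun z => (z == y)%:R - pi 0 y) x =
  Pt M (fun z => Z z y - pi 0 y) x - Pt M (avg P (fun z => Z z y - pi 0 y)) x by ring.
rewrite -avgB; apply: eq_bigr => z _; congr (_ * _).
rewrite -(fundamental_eq P pi P_stoch P_irr pi_stat).
have := avgB 1 (Z^~ y) (fun=> pi 0 y) z; rewrite expr1 => ->.
by have := avg_const 1 (pi 0 y) z; rewrite expr1 => ->; ring.
Qed.

Lemma fundamental_sum_series : fundamental_series P pi fundamental_sum.
Proof.
rewrite /fundamental_series => x y; under eq_fun do rewrite partial_sum_fundamental.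
have lim := @avg_cvg0 _ (centered_fundamental y) x.
have := cvgB (cvg_cst (fundamental_sum x y)) lim.
by rewrite subr0; exact.
Qed.

(* The block bound is at most [(1 - p) + 1/4 + (1/4 + p) / 2] from above and
   [p + 1/4 + (1/4 + (1 - p)) / 2] from below, where [p = pi 0 i]. Both are at
   most [11/8], which is just below the required [2 ln 2]. *)
Lemma partial_sum_norm_le i x L :
  `|\sum_(0 <= t < L.+2 * m) ((P ^+ t) x i - pi 0 i)| <= 11 / 8 * m%:R.
Proof.
have p0 := stationary_gt0 P pi P_stoch P_irr pi_stat i.
have p1 := stationary_le1 P pi pi_stat i.
set f := fun z : 'I_n => (z == i)%:R - pi 0 i.
have cf : centered f := centered_indicator i.
have fl t z : - pi 0 i <= Pt t f z.
  by apply: avg_ge => y; rewrite /f; case: (y == i) => /=; lra.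
have fu t z : Pt t f z <= 1 - pi 0 i.
  by apply: avg_le => y; rewrite /f; case: (y == i) => /=; lra.
have f1 r z : `|Pt (m + r) f z| <= 1 / 4.
  by apply: avg_norm_le => // a b; have := fl r b; have := fu r a; lra.
have f2 (o : R) l r z : 1 / 4 + pi 0 i <= o \/ 1 / 4 + (1 - pi 0 i) <= o ->
    `|Pt (l.+2 * m + r) f z| <= o * 2^-1 ^+ l / 4.
  move=> ho; have -> : (l.+2 * m + r = m + (l * m + (m + r)))%N by lia.
  apply: avg_norm_le => //; apply: avg_osc_iter => a b.
  have := f1 r a; have := f1 r b; rewrite !ler_norml.
  have := fl (m + r)%N b; have := fu (m + r)%N a.
  by case: ho; lra.
under eq_bigr do rewrite -avg_indicator -/f.
rewrite ler_norml; apply/andP; split.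
  rewrite lerNl -sumrN.
  apply: le_trans (@sum_blocks_le _ _ m L (pi 0 i) (1/4 + (1 - pi 0 i)) _ _ _ _) _.
  - lra.
  - by move=> t; have := fl t x; lra.
  - by move=> r; have := f1 r x; rewrite ler_norml; lra.
  - by move=> l r; have := f2 _ l r x (or_intror (lexx _)); rewrite ler_norml; lra.
  - by rewrite mulrC ler_wpM2r//; lra.
apply: le_trans (@sum_blocks_le _ _ m L (1 - pi 0 i) (1/4 + pi 0 i) _ _ _ _) _.
- lra.
- by move=> t; have := fu t x; lra.
- by move=> r; have := f1 r x; rewrite ler_norml; lra.
- by move=> l r; have := f2 _ l r x (or_introl (lexx _)); rewrite ler_norml; lra.
- by rewrite mulrC ler_wpM2r//; lra.
Qed.

Lemma Zmax_fundamental_sum_le i : Zmax fundamental_sum i <= 11 / 8 * m%:R.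
Proof.
apply: bigmax_le => [|x _]; first by rewrite mulr_ge0//; lra.
have := fundamental_sum_series x i => lim.
(* The block bound speaks of multiples of [m], so the limit is taken along that subsequence. *)
have {}lim : (fun L => \sum_(0 <= t < L.+2 * m) ((P ^+ t) x i - pi 0 i)) @ \oo -->
    fundamental_sum x i.
  apply: (cvg_comp (fun L => (L.+2 * m)%N) _ _ lim).
  move=> A [N _ hN]; exists N => // L /= NL; apply: hN => /=.
  by apply: leq_trans NL _; rewrite mulSn (leq_trans _ (leq_addl _ _))// mulSn;
    rewrite (leq_trans _ (leq_addl _ _))// leq_pmulr.
have {}lim : (fun L => `|\sum_(0 <= t < L.+2 * m) ((P ^+ t) x i - pi 0 i)|) @ \oo -->
    `|fundamental_sum x i| by apply: cvg_norm.
rewrite -(cvg_lim _ lim)//; apply: limr_le; first by apply: cvgP lim.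
by near=> L; exact: partial_sum_norm_le.
Unshelve. all: by end_near. Qed.

End Mixing.

Lemma mixing_timeP {R : realType} {n : nat} (P : 'M[R]_n) (pi : 'rV[R]_n) :
  (mixing_time P pi < +oo)%E ->
  exists m : nat, [/\ (0 < m)%N, mixing_time P pi = m%:R%:E &
    \big[Num.max/0]_(x < n) tv_dist (row x (P ^+ m)) pi <= 4^-1].
Proof.
rewrite /mixing_time; set S := [set _ | _ in _] => tm.
pose good t := (0 < t)%N && (\big[Num.max/0]_(x < n) tv_dist (row x (P ^+ t)) pi <= 4^-1).
have ex : exists t, good t.
  apply: contrapT => /forallNP h; move: tm.
  suff -> : S = set0 by rewrite ereal_inf0 ltxx.
  rewrite -subset0 => y [t [t0 tt] _]; apply: (h t); apply/andP; split => //.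
exists (ex_minn ex); case: ex_minnP => m /andP[m0 mm] mmin; split => //.
apply/eqP; rewrite eq_le; apply/andP; split.
  by apply: ereal_inf_lbound; exists m.
apply: le_ereal_inf_tmp => y [t [t0 tt] <-]; rewrite lee_fin ler_nat.
by apply: mmin; apply/andP.
Qed.

(** * Countably valued random variables and first hits *)

Section DiscreteMeasurability.
Context {T : Type}.
Variable S : set (set T).
Hypothesis S_sigma : sigma_algebra setT S.

(** All preimages are required, so [V] needs no sigma-algebra and any function of such a variable
    keeps the property. This fits variables that factor through a countable type. *)
Definition dmeas {V : Type} (F : T -> V) : Prop :=
  forall B : set V, S (F @^-1` B).

Lemma sigma_setC A : S A -> S (~` A).
Proof. by case: S_sigma => _ SC _ /SC; rewrite setTD. Qed.

Lemma sigma_bigcup {V : countType} (A : V -> set T) :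
  (forall v, S (A v)) -> S (\bigcup_v A v).
Proof.
move=> SA; case: S_sigma => S0 _ SU.
have -> : \bigcup_v A v = \bigcup_k (if unpickle k is Some v then A v else set0).
  apply/seteqP; split => w /=.
    by move=> [v _ Avw]; exists (pickle v) => //; rewrite pickleK.
  by move=> [k _]; case: (unpickle k) => // v Avw; exists v.
by apply: SU => k; case: (unpickle k).
Qed.

Lemma sigma_setT : S setT.
Proof. by rewrite -setC0; apply: sigma_setC; case: S_sigma. Qed.

Lemma sigma_setU A B : S A -> S B -> S (A `|` B).
Proof.
move=> SA SB; have -> : A `|` B = \bigcup_(b : bool) (if b then A else B).
  apply/seteqP; split => w /=.
    by case=> h; [exists true|exists false].
  by case=> -[] _ h; [left|right].
by apply: sigma_bigcup => -[].
Qed.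

Lemma sigma_setI A B : S A -> S B -> S (A `&` B).
Proof.
by move=> SA SB; rewrite -[_ `&` _]setCK setCI; apply/sigma_setC/sigma_setU; exact: sigma_setC.
Qed.

Lemma dmeas_comp {V W : Type} (g : V -> W) (F : T -> V) :
  dmeas F -> dmeas (fun w => g (F w)).
Proof. by move=> mF B; apply: (mF (g @^-1` B)). Qed.

(** Handles adaptive choices, such as a number of samples determined by earlier samples. *)
Lemma dmeas_bind {V : countType} {W : Type} (F : T -> V) (G : V -> T -> W) :
  dmeas F -> (forall v, dmeas (G v)) ->
  dmeas (fun w => G (F w) w).
Proof.
move=> mF mG B.
have -> : (fun w => G (F w) w) @^-1` B =
    \bigcup_v ((F @^-1` [set v]) `&` (G v @^-1` B)).
  apply/seteqP; split => w /=; first by move=> h; exists (F w).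
  by move=> [v _ [<-]].
by apply: sigma_bigcup => v; apply: sigma_setI; [exact: mF|exact: mG].
Qed.

Lemma dmeas_cst {V : Type} (v : V) : dmeas (fun=> v).
Proof.
move=> B; have [Bv|Bv] := pselect (B v).
  by rewrite (_ : _ @^-1` _ = setT); [exact: sigma_setT|apply/seteqP; split].
by rewrite (_ : _ @^-1` _ = set0); [case: S_sigma|apply/seteqP; split].
Qed.

Lemma dmeas_bind2 {V V' : countType} {W : Type} (F : T -> V) (F' : T -> V')
    (g : V -> V' -> W) :
  dmeas F -> dmeas F' ->
  dmeas (fun w => g (F w) (F' w)).
Proof.
move=> mF mF'; apply: (@dmeas_bind V W F (fun v w => g v (F' w))) => // v.
exact: dmeas_comp.
Qed.

Lemma dmeas_singletons {V : countType} (F : T -> V) :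
  (forall v, S (F @^-1` [set v])) -> dmeas F.
Proof.
move=> mF B; have -> : F @^-1` B = \bigcup_(v : V) [set w | F w = v /\ B v].
  apply/seteqP; split => w /=; first by move=> h; exists (F w).
  by move=> [v _ /= [<-]].
apply: sigma_bigcup => v; have [Bv|Bv] := pselect (B v).
  rewrite (_ : [set _ | _] = F @^-1` [set v])//.
  by apply/seteqP; split => w //= [].
by rewrite (_ : [set _ | _] = set0); [case: S_sigma|apply/seteqP; split => w //= []].
Qed.

Lemma dmeas_Prop (p : T -> Prop) : S [set w | p w] -> dmeas p.
Proof.
move=> Sp B; have -> : p @^-1` B =
  ([set w | p w] `&` (fun=> True) @^-1` B) `|` (~` [set w | p w] `&` (fun=> False) @^-1` B).
  apply/seteqP; split => w /=.
    move=> Bp; have [pw|pw] := pselect (p w); [left|right]; split=> //; move: Bp.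
      by rewrite (_ : p w = True)//; apply/propext; split.
    by rewrite (_ : p w = False)//; apply/propext; split.
  case=> -[pw].
    by rewrite (_ : p w = True)//; apply/propext; split.
  by rewrite (_ : p w = False)//; apply/propext; split.
apply: sigma_setU; apply: sigma_setI => //; try exact: dmeas_cst.
exact: sigma_setC.
Qed.

Lemma dmeas_set (p : T -> Prop) : dmeas p -> S [set w | p w].
Proof. by move=> /(_ id). Qed.

Lemma dmeas_forall {V : countType} (p : V -> T -> Prop) :
  (forall v, dmeas (p v)) -> dmeas (fun w => forall v, p v w).
Proof.
move=> mp; apply: dmeas_Prop.
have -> : [set w | forall v, p v w] = ~` \bigcup_v ~` [set w | p v w].
  apply/seteqP; split => w /=; first by move=> h [v _]; apply; exact: h.
  by move=> h v; apply: contrapT => pvw; apply: h; exists v.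
by apply/sigma_setC/sigma_bigcup => v; apply/sigma_setC/dmeas_set.
Qed.

Lemma dmeas_exists {V : countType} (p : V -> T -> Prop) :
  (forall v, dmeas (p v)) -> dmeas (fun w => exists v, p v w).
Proof.
move=> mp; apply: dmeas_Prop.
have -> : [set w | exists v, p v w] = \bigcup_v [set w | p v w].
  by apply/seteqP; split => w /= [v]; exists v.
by apply: sigma_bigcup => v; exact: dmeas_set.
Qed.

Lemma dmeas_and (p q : T -> Prop) :
  dmeas p -> dmeas q ->
  dmeas (fun w => p w /\ q w).
Proof.
by move=> mp mq; apply: dmeas_Prop; apply: sigma_setI; exact: dmeas_set.
Qed.

Lemma dmeas_imp (p : Prop) (q : T -> Prop) : dmeas q ->
  dmeas (fun w => p -> q w).
Proof.
move=> mq; have [hp|hp] := pselect p.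
  have -> : (fun w => p -> q w) = q by apply/funext => w; apply/propext; tauto.
  exact: mq.
have -> : (fun w => p -> q w) = fun=> True by apply/funext => w; apply/propext; tauto.
exact: dmeas_cst.
Qed.

Lemma dmeas_map {V : countType} {I : Type} (F : I -> T -> V) (s : seq I) :
  (forall j, dmeas (F j)) ->
  dmeas (fun w => [seq F j w | j <- s]).
Proof.
move=> mF; elim: s => [|j s ih] /=; first exact: dmeas_cst.
exact: dmeas_bind2.
Qed.

End DiscreteMeasurability.

(** * First hits along a fixed path *)

Section Walk.
Context {n : nat}.
Variable i : 'I_n.
Implicit Type x : nat -> 'I_n.

Definition avoids x (t : nat) : bool := all (fun s => x s != i) (iota 1 t).

Lemma avoidsP x t : reflect (forall s, (1 <= s <= t)%N -> x s != i) (avoids x t).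
Proof.
apply: (iffP allP) => h s hs; apply: h; first by rewrite mem_iota add1n ltnS.
by move: hs; rewrite mem_iota add1n ltnS.
Qed.

Lemma avoids_le x s t : (s <= t)%N -> avoids x t -> avoids x s.
Proof.
move=> st /avoidsP h; apply/avoidsP => r /andP[r1 rs]; apply: h.
by rewrite r1 (leq_trans rs).
Qed.

Lemma ltn_walk_length th x t : (0 < th)%N ->
  (t < walk_length i th x)%N = (t < th)%N && avoids x t.
Proof.
(* The search is generalised to an arbitrary first time [a], so that the induction can peel off the
   head of the list. *)
suff h k a : th = (a + k)%N ->
    (t < head th [seq s <- iota a k.+1 | (s == th) || (x s == i)])%N =
    (t < th)%N && all (fun s => x s != i) (iota a (t.+1 - a)).
  by case: th h => // th h _; rewrite /walk_length h ?add1n// subn1.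
elim: k a => [|k ih] a E.
  rewrite addn0 in E; rewrite /= -E eqxx/=; case: ltnP => //= tth.
  by rewrite (_ : (t.+1 - th = 0)%N)//; apply/eqP; rewrite subn_eq0.
rewrite [iota a _]/=; rewrite /= -/(iota _ k.+1).
have -> : (a == th) = false by lia.
have [tlta|ta] := ltnP t a.
  have -> : (t.+1 - a = 0)%N by lia.
  rewrite /= andbT; case: ifP => _ /=; first by lia.
  rewrite -[head _ _]/(head th [seq s <- iota a.+1 k.+1 | (s == th) || (x s == i)]).
  rewrite ih; last by lia.
  by rewrite (_ : (t.+1 - a.+1 = 0)%N) /= ?andbT//; lia.
have -> : (t.+1 - a = (t.+1 - a.+1).+1)%N by lia.
case: ifP => /= xa; first by rewrite xa/= andbF; lia.
rewrite -[head _ _]/(head th [seq s <- iota a.+1 k.+1 | (s == th) || (x s == i)]).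
by rewrite ih ?xa//; lia.
Qed.

Lemma nat_eq_ltn (a b : nat) : (forall t, (t < a)%N = (t < b)%N) -> a = b.
Proof.
by move=> h; apply/eqP; rewrite eqn_leq leqNgt h ltnn/= leqNgt -h ltnn.
Qed.

Lemma walk_length_minn th x : (0 < th)%N ->
  walk_length i th x = minn (walk_length i th.+1 x) th.
Proof.
move=> th0; apply: nat_eq_ltn => t.
rewrite leq_min !ltn_walk_length// ltnS; case: (ltnP t th) => //=; rewrite ?andbT ?andbF//.
by move=> /ltnW ->.
Qed.

Lemma walk_length_le th x : (0 < th)%N -> (walk_length i th x <= th)%N.
Proof. by move=> th0; rewrite leqNgt ltn_walk_length// ltnn. Qed.

Lemma hitting_time_gt (R : realType) th x :
  ((th%:R)%:E < hitting_time R i x)%E = avoids x th.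
Proof.
rewrite /hitting_time; set S := [set _ | _ in _].
apply/idP/avoidsP => [lt s /andP[s1 sth]|h].
  apply/eqP => xs; move: lt; rewrite ltNge => /negP; apply.
  apply: (@le_trans _ _ (s%:R%:E)); last by rewrite lee_fin ler_nat.
  by apply: ereal_inf_lbound; exists s.
apply: (@lt_le_trans _ _ (th.+1%:R%:E)); first by rewrite lte_fin ltr_nat.
apply: le_ereal_inf_tmp => _ [s [s1 xs] <-]; rewrite lee_fin ler_nat ltnNge.
by apply/negP => sth; have := h s; rewrite s1 sth xs eqxx => /(_ isT).
Qed.

(** The tail-sum formula holds path by path, so the expectation needs only an exchange of sum and
    integral. A path that never hits is separate: there both sides are infinite. *)
Lemma hitting_time_series (R : realType) x :
  hitting_time R i x = \big[+%E/0]_(0 <= t <oo) ((avoids x t)%:R : R)%:E.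
Proof.
have [ex|nex] := pselect (exists t, ~~ avoids x t); last first.
  have av t : avoids x t by apply: contrapT => h; apply: nex; exists t; exact/negP.
  have -> : hitting_time R i x = +oo%E.
    apply/eqyP => A A0; have [k kA] : exists k : nat, A < k%:R.
      by exists (Num.bound `|A|); exact: le_lt_trans (ler_norm A) (archi_boundP (normr_ge0 A)).
    apply: (@le_trans _ _ (k%:R%:E)); first by rewrite lee_fin ltW.
    by rewrite ltW// hitting_time_gt.
  apply/esym/eqyP => A A0; have [k kA] : exists k : nat, A < k%:R.
    by exists (Num.bound `|A|); exact: le_lt_trans (ler_norm A) (archi_boundP (normr_ge0 A)).
  apply: (@le_trans _ _ (k%:R%:E)); first by rewrite lee_fin ltW.
  apply: le_trans (nneseries_lim_ge k _); last by move=> *; rewrite lee_fin ler0n.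
  rewrite sumEFin lee_fin; under eq_bigr do rewrite av.
  by rewrite sumr_const_nat subn0.
case: (ex_minnP ex) => s xs smin.
have av t : avoids x t = (t < s)%N.
  apply/idP/idP => [h|ts]; last by apply: contraTT ts => /smin; rewrite -leqNgt.
  by rewrite ltnNge; apply: contraNN xs => st; exact: avoids_le h.
have s0 : (0 < s)%N by case: s xs {smin av}.
have xsi : x s = i.
  apply: contraNeq xs => xsi; apply/avoidsP => r /andP[r1]; rewrite leq_eqVlt.
  move=> /predU1P[->//|rs]; have := av r; rewrite rs => /avoidsP; apply.
  by rewrite r1/=.
have -> : hitting_time R i x = (s%:R)%:E.
  apply/eqP; rewrite eq_le; apply/andP; split.
    by apply: ereal_inf_lbound; exists s.
  apply: le_ereal_inf_tmp => _ [t [t1 xt] <-]; rewrite lee_fin ler_nat.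
  apply: smin; apply/avoidsP => /(_ t); rewrite t1 leqnn => /(_ isT).
  by rewrite xt eqxx.
rewrite (@nneseries_split _ _ 0 s); last by move=> *; rewrite lee_fin ler0n.
rewrite add0n eseries0 ?adde0; last by move=> t st _; rewrite av ltnNge st.
rewrite sumEFin big_nat; under eq_bigr => t /andP[_ ts] do rewrite av ts.
by rewrite -big_nat sumr_const_nat subn0.
Qed.

End Walk.

(** * The law of the hitting time *)

Section FiniteProbability.
Context {d : measure_display} {T : measurableType d} {R : realType}.
Variable Pr : probability T R.

Definition prob (A : set T) : R := fine (Pr A).

Lemma probE A : measurable A -> Pr A = (prob A)%:E.
Proof. by move=> mA; rewrite fineK// fin_num_measure. Qed.

Lemma prob_ge0 A : 0 <= prob A.
Proof. exact: fine_ge0. Qed.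

Lemma prob_le A B : measurable A -> measurable B -> A `<=` B -> prob A <= prob B.
Proof.
by move=> mA mB AB; rewrite -lee_fin -!probE// le_measure ?inE.
Qed.

Lemma prob_set0 : prob set0 = 0.
Proof. by rewrite /prob measure0. Qed.

Lemma prob_partition (A : set T) (F : T -> nat) (N : nat) : measurable A ->
  (forall v, measurable [set w | F w = v]) -> (forall w, A w -> (F w < N)%N) ->
  prob A = \sum_(v < N) prob (A `&` [set w | F w = v]).
Proof.
move=> mA mF FN.
have mI (v : 'I_N) : measurable (A `&` [set w | F w = v]) by exact: measurableI.
apply: EFin_inj; rewrite -probE// -sumEFin.
under [RHS]eq_bigr do rewrite -probE//.
rewrite -measure_semi_additive_ord//.
- congr (Pr _).
  rewrite -(bigcup_mkord N (fun v => A `&` [set w | F w = v])).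
  apply/seteqP; split => w /=; first by move=> Aw; exists (F w); [exact: FN|].
  by move=> [v /= vN [Aw _]].
- by apply/trivIsetP => a b _ _ ab; apply/seteqP; split => // w /= [[_ Fa] [_ Fb]];
    move/eqP: ab; apply; apply/ord_inj; rewrite -Fa -Fb.
- exact: bigsetU_measurable.
Qed.

Lemma probU_le A B : measurable A -> measurable B ->
  prob (A `|` B) <= prob A + prob B.
Proof.
move=> mA mB; rewrite -lee_fin EFinD -!probE//; last exact: measurableU.
exact: measureU2.
Qed.

Lemma probC A : measurable A -> prob (~` A) = 1 - prob A.
Proof.
move=> mA; apply: EFin_inj; rewrite EFinB -!probE//; last exact: measurableC.
exact: probability_setC.
Qed.

Lemma prob_setI_full A B : measurable A -> measurable B -> prob B = 1 ->
  prob (A `&` B) = prob A.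
Proof.
move=> mA mB B1; have mAB : measurable (A `&` B) by exact: measurableI.
have mC : measurable (~` B) by exact: measurableC.
apply/eqP; rewrite eq_le prob_le//=.
apply: (@le_trans _ _ (prob ((A `&` B) `|` ~` B))).
  apply: prob_le => //; first exact: measurableU.
  by move=> w Aw; have [Bw|Bw] := pselect (B w); [left|right].
by apply: le_trans (probU_le _ _ mAB mC) _; rewrite probC// B1 subrr addr0.
Qed.

End FiniteProbability.

Section MarkovLaw.
Context {d : measure_display} {T : measurableType d} {R : realType} {n : nat}.
Variables (Pr : probability T R) (P : 'M[R]_n) (i j : 'I_n) (X : nat -> T -> 'I_n).
Hypothesis X_chain : markov_chain Pr P j X.

Lemma dmeas_state t : dmeas measurable (X t).
Proof.
apply: dmeas_singletons; first exact: sigma_algebra_measurable.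
by move=> v; case: X_chain => mX _ _; exact: mX.
Qed.

Definition cylinder (m : nat) (x : nat -> 'I_n) : set T :=
  [set w | forall s, (s <= m)%N -> X s w = x s].

Definition taboo_cylinder (l m : nat) (x : nat -> 'I_n) : set T :=
  cylinder l x `&` [set w | forall s, (l < s <= m)%N -> X s w != i].

Lemma measurable_cylinder m x : measurable (cylinder m x).
Proof.
apply: dmeas_set; apply: dmeas_forall => [|s]; first exact: sigma_algebra_measurable.
apply: dmeas_imp; first exact: sigma_algebra_measurable.
by apply: dmeas_comp (fun y => y = x s) _ _; exact: dmeas_state.
Qed.

Lemma measurable_taboo l m x : measurable (taboo_cylinder l m x).
Proof.
apply: measurableI; first exact: measurable_cylinder.
apply: dmeas_set; apply: dmeas_forall => [|s]; first exact: sigma_algebra_measurable.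
apply: dmeas_imp; first exact: sigma_algebra_measurable.
by apply: dmeas_comp (fun y => is_true (y != i)) _ _; exact: dmeas_state.
Qed.

Lemma prob_cylinderS m x :
  prob Pr (cylinder m.+1 x) = prob Pr (cylinder m x) * P (x m) (x m.+1).
Proof.
case: X_chain => _ _ XP; apply: EFin_inj.
rewrite EFinM -!probE; try exact: measurable_cylinder.
exact: XP.
Qed.

(** The Markov property is given only for fully prescribed prefixes. Splitting by the state at time
    [l + 1] lengthens the prefix by one, which is why [l] and [x] vary in the induction. *)
Lemma prob_taboo_cylinder k l x :
  prob Pr (taboo_cylinder l (l + k) x) = prob Pr (cylinder l x) * hit_tail P i k (x l).
Proof.
elim: k l x => [|k ih] l x.
  rewrite addn0 /hit_tail/= mulr1 /taboo_cylinder; congr (prob Pr _).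
  by apply/seteqP; split => w /=; [case|split => // s; lia].
rewrite (@prob_partition _ _ _ Pr _ (fun w => X l.+1 w : nat) n); first last.
- by move=> w _; exact: ltn_ord.
- move=> v; apply: (dmeas_comp _ (fun y : 'I_n => y : nat) (X l.+1) _ [set v]).
  exact: dmeas_state.
- exact: measurable_taboo.
rewrite hit_tailS /taboo_op mulr_sumr [RHS]big_mkcond/=; apply: eq_bigr => y _.
case: ifPn => [yi|]; last first.
  rewrite negbK => /eqP yi; rewrite [X in prob _ X](_ : _ = set0) ?prob_set0//.
  apply/seteqP; split => // w /= [[_ h] /ord_inj Xy].
  by have := h l.+1; rewrite Xy yi eqxx => /(_ _)/notF; apply; lia.
pose x' s := if s == l.+1 then y else x s.
rewrite (_ : _ `&` _ = taboo_cylinder l.+1 (l.+1 + k) x'); last first.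
  apply/seteqP; split => w /=.
    move=> [[h1 h2] /ord_inj Xy]; split => s hs.
      rewrite /x'; case: eqP => [->//|/eqP sl]; apply: h1; lia.
    apply: h2; lia.
  move=> [h1 h2]; split; first split.
  - by move=> s sl; rewrite h1 /x' ?ltn_eqF//; lia.
  - move=> s hs; have [->|sl] := eqVneq s l.+1; first by rewrite h1// /x' eqxx.
    by apply: h2; lia.
  - by rewrite h1// /x' eqxx.
rewrite ih prob_cylinderS /x' eqxx ltn_eqF// mulrA; congr (prob Pr _ * _ * _).
by apply/seteqP; split => w /= h s sl; have := h s sl; rewrite ltn_eqF.
Qed.

Lemma prob_avoids t : prob Pr [set w | avoids i (X^~ w) t] = hit_tail P i t j.
Proof.
have mA : measurable [set w | avoids i (X^~ w) t].
  have -> : [set w | avoids i (X^~ w) t] =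
      [set w | forall s, (1 <= s <= t)%N -> X s w != i].
    by apply/seteqP; split => w /= /avoidsP.
  apply: dmeas_set; apply: dmeas_forall => [|s]; first exact: sigma_algebra_measurable.
  apply: dmeas_imp; first exact: sigma_algebra_measurable.
  by apply: dmeas_comp (fun y => is_true (y != i)) _ _; exact: dmeas_state.
have X0 : prob Pr (cylinder 0 (fun=> j)) = 1.
  case: X_chain => _ X0 _; rewrite /prob -[RHS]/(fine 1%E) -X0; congr (fine (Pr _)).
  by apply/seteqP; split => w /= h; [apply: h|case].
have := prob_taboo_cylinder t 0 (fun=> j); rewrite add0n X0 mul1r => <-.
have mC : measurable (cylinder 0 (fun=> j)) by exact: measurable_cylinder.
rewrite -(prob_setI_full Pr _ _ mA mC X0); congr (prob Pr _).
by apply/seteqP; split => w /= [h1 h2]; split => //; apply/avoidsP.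
Qed.

Lemma measurable_avoids t : measurable [set w | avoids i (X^~ w) t].
Proof.
have -> : [set w | avoids i (X^~ w) t] =
    [set w | forall s, (1 <= s <= t)%N -> X s w != i].
  by apply/seteqP; split => w /= /avoidsP.
apply: dmeas_set; apply: dmeas_forall => [|s]; first exact: sigma_algebra_measurable.
apply: dmeas_imp; first exact: sigma_algebra_measurable.
by apply: dmeas_comp (fun y => is_true (y != i)) _ _; exact: dmeas_state.
Qed.

Lemma expectation_hitting_time :
  (\int[Pr]_w hitting_time R i (X^~ w))%E =
  \big[+%E/0]_(0 <= t <oo) (hit_tail P i t j)%:E.
Proof.
pose A t := [set w | avoids i (X^~ w) t].
transitivity (\int[Pr]_w \big[+%E/0]_(0 <= t <oo) (\1_(A t) w)%:E)%E.
  apply: eq_integral => w _; rewrite hitting_time_series; apply: eq_eseriesr => t _.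
  rewrite indicE; congr (_%:R%:E); apply/esym.
  by case: (boolP (avoids _ _ _)) => h; [rewrite mem_set|rewrite memNset//; exact/negP].
rewrite integral_nneseries//.
- apply: eq_eseriesr => t _; rewrite integral_indic//; last exact: measurable_avoids.
  by have := probE Pr (A t) (measurable_avoids t); rewrite prob_avoids setIT.
- by move=> t; apply/measurable_EFinP; apply: measurable_indic; exact: measurable_avoids.
Qed.

End MarkovLaw.

(** [mean_hit] dominates the expectations, which makes the maximum finite. The partial sums serve
    the bound on the threshold, the last clause the comparison with the mixing time. *)
Lemma max_hitting_time_spec {d : measure_display} {T : measurableType d} {R : realType}
    {n : nat} (Pr : probability T R) (P : 'M[R]_n) (pi : 'rV[R]_n) (i : 'I_n)
    (Y : 'I_n -> nat -> T -> 'I_n) :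
  stochastic P -> irreducible P -> stationary P pi ->
  (forall j, markov_chain Pr P j (Y j)) ->
  exists h : R, [/\ max_hitting_time Pr Y i = h%:E, 1 <= h,
    forall m x, \sum_(0 <= t < m) hit_tail P i t x <= h &
    forall B, (forall x, mean_hit P pi i x <= B) -> h <= B].
Proof.
move=> P_stoch P_irr pi_stat Y_chain.
pose e x := \big[+%E/0]_(0 <= t <oo) (hit_tail P i t x)%:E.
have HE : max_hitting_time Pr Y i = \big[maxe/0%E]_(x < n) e x.
  apply: eq_bigr => x _; exact: (expectation_hitting_time Pr P i x).
have tail0 t x : (0 <= (hit_tail P i t x)%:E)%E by rewrite lee_fin hit_tail_ge0.
have e_ge m x : ((\sum_(0 <= t < m) hit_tail P i t x)%:E <= e x)%E.
  by rewrite -sumEFin; apply: nneseries_lim_ge => *; exact: tail0.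
have e_le x : (e x <= (mean_hit P pi i x)%:E)%E.
  apply: lime_le; first by apply: is_cvg_nneseries => *; exact: tail0.
  by near=> m; rewrite sumEFin lee_fin; exact: sum_hit_tail_le.
have H_le B : (forall x, mean_hit P pi i x <= B) -> (max_hitting_time Pr Y i <= B%:E)%E.
  move=> hB; rewrite HE; apply: bigmax_le => [|x _].
    by rewrite lee_fin; apply: le_trans (hB i); exact: mean_hit_ge0.
  by apply: le_trans (e_le x) _; rewrite lee_fin.
have H_ge m x : ((\sum_(0 <= t < m) hit_tail P i t x)%:E <= max_hitting_time Pr Y i)%E.
  by apply: le_trans (e_ge m x) _; rewrite HE; exact: le_bigmax.
have Hfin : max_hitting_time Pr Y i \is a fin_num.
  pose M := \big[Num.max/0]_x mean_hit P pi i x.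
  have := H_le M (fun x => le_bigmax _ _ x); have := H_ge 0%N i.
  rewrite big_geq//; case: (max_hitting_time _ _ _) => //.
exists (fine (max_hitting_time Pr Y i)); split; first by rewrite fineK.
- by rewrite -lee_fin fineK//; have := H_ge 1%N i; rewrite big_nat1.
- by move=> m x; rewrite -lee_fin fineK.
- by move=> B hB; rewrite -lee_fin fineK// H_le.
Unshelve. all: by end_near. Qed.

(** * Chernoff bounds from the product rule *)

(** By convexity the exponential lies below its chord on [[0, 1]], for either sign of [s]. *)
Lemma mgf_le {R : realType} (N : nat) (q y : nat -> R) (s : R) :
  (forall v, 0 <= q v) -> \sum_(v < N) q v = 1 -> (forall v, 0 <= y v <= 1) ->
  \sum_(v < N) q v * expR (s * y v) <= 1 + (\sum_(v < N) q v * y v) * (expR s - 1).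
Proof.
move=> q0 q1 y01; rewrite -[X in X + _]q1 mulr_suml -big_split/=.
apply: ler_sum => v _; rewrite -mulrA -[X in X + _]mulr1 -mulrDr ler_wpM2l//.
have /andP[y0 y1] := y01 v.
have := @convex_expR R (Itv01 y0 y1) s 0.
rewrite !convRE /unstable.onem /= mulr0 addr0 expR0 mulr1 mulrC => /le_trans; apply.
by rewrite le_eqVlt; apply/orP; left; apply/eqP; ring.
Qed.

Section Concentration.
Context {d : measure_display} {T : measurableType d} {R : realType}.
Variable Pr : probability T R.

Lemma probU A B : measurable A -> measurable B -> A `&` B = set0 ->
  prob Pr (A `|` B) = prob Pr A + prob Pr B.
Proof.
move=> mA mB AB; apply: EFin_inj; rewrite EFinD -!probE//; last exact: measurableU.
by rewrite measureU.
Qed.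

Lemma prob_eq_tails (F G : T -> nat) : dmeas measurable F -> dmeas measurable G ->
  (forall t, prob Pr [set w | (t < F w)%N] = prob Pr [set w | (t < G w)%N]) ->
  forall v, prob Pr [set w | F w = v] = prob Pr [set w | G w = v].
Proof.
move=> mF mG FG.
have split (H : T -> nat) v : dmeas measurable H ->
    prob Pr [set w | (v <= H w)%N] =
    prob Pr [set w | H w = v] + prob Pr [set w | (v < H w)%N].
  move=> mH; rewrite -probU.
  - congr (prob Pr _); apply/seteqP; split => w /=.
      by rewrite leq_eqVlt => /orP[/eqP ->|]; [left|right].
    by case=> [->//|/ltnW].
  - exact: (mH [set v]).
  - exact: (mH [set u | (v < u)%N]).
  - by apply/seteqP; split => w //= [->]; rewrite ltnn.
move=> v; suff : prob Pr [set w | (v <= F w)%N] = prob Pr [set w | (v <= G w)%N].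
  by rewrite (split F)// (split G)// FG => /addIr.
by case: v => [|v]; [|exact: FG].
Qed.

(** Conditioning on a discrete variable, multiplied out to avoid division. Values are enumerated by
    [pickle]; a number that codes no value gives an empty piece. *)
Lemma prob_le_conditional {V : countType} (F : T -> V) (B : set T) (b : R) :
  dmeas measurable F -> measurable B -> 0 <= b ->
  (forall v, prob Pr ([set w | F w = v] `&` B) <= prob Pr [set w | F w = v] * b) ->
  prob Pr B <= b.
Proof.
move=> mF mB b0 FB.
pose A k := [set w | pickle (F w) = k].
have mA k : measurable (A k) by exact: (mF (pickle @^-1` [set k])).
have AB k : (Pr (A k `&` B) <= (prob Pr (A k) * b)%:E)%E.
  rewrite probE; last exact: measurableI.
  rewrite lee_fin; have [[v vk]|nv] := pselect (exists v : V, pickle v = k).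
    rewrite (_ : A k = [set w | F w = v])//.
    apply/seteqP; split => w; rewrite /A/=; last by move=> ->.
    by rewrite -vk => /(pcan_inj pickleK).
  rewrite (_ : A k = set0); first by rewrite set0I prob_set0 mul0r.
  by apply/seteqP; split => w //= Aw; apply: nv; exists (F w).
rewrite -lee_fin -probE//.
have sub : B `<=` \bigcup_k (A k `&` B) by move=> w Bw; exists (pickle (F w)).
have mAB k : measurable (A k `&` B) by exact: measurableI.
apply: le_trans (measure_sigma_subadditive Pr mAB mB sub) _.
apply: (@le_trans _ _ (\big[+%E/0]_(0 <= k <oo) (prob Pr (A k) * b)%:E)%E).
  by apply: lee_nneseries => // k _; exact: AB.
apply: lime_le.
  by apply: is_cvg_nneseries => k _ _; rewrite lee_fin mulr_ge0// prob_ge0.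
near=> m; rewrite sumEFin lee_fin -mulr_suml ler_piMl//.
have mU : measurable [set w | (pickle (F w) < m)%N].
  exact: (mF [set v | (pickle v < m)%N]).
have -> : \sum_(0 <= k < m) prob Pr (A k) = prob Pr [set w | (pickle (F w) < m)%N].
  rewrite (@prob_partition _ _ _ Pr _ (fun w => pickle (F w)) m)//.
  rewrite big_mkord; apply: eq_bigr => k _; congr (prob Pr _).
  by apply/seteqP; split => w; rewrite /A/=; [move=> ->|case].
rewrite -lee_fin -probE//; exact: probability_le1.
Unshelve. all: by end_near. Qed.

Section ExponentialMoment.
Context {I : eqType}.
Variables (E : I -> set (set T)) (D : I -> T -> nat) (N : nat) (q phi : nat -> R).
Hypothesis E_sub : forall j, E j `<=` measurable.
Hypothesis E_indep : forall (s : seq I) (A : I -> set T),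
  uniq s -> (forall j, j \in s -> E j (A j)) ->
  Pr (\big[setI/setT]_(j <- s) A j) = (\prod_(j <- s) Pr (A j))%E.
Hypothesis mD : forall j, dmeas (E j) (D j).

Lemma dmeas_sub j : dmeas measurable (D j).
Proof. by move=> B; apply: E_sub; exact: mD. Qed.

Lemma measurable_rectangle (r : seq I) (A : I -> set T) :
  (forall j, j \in r -> E j (A j)) -> measurable (\big[setI/setT]_(j <- r) A j).
Proof.
elim: r => [|j r ih] rA; first by rewrite big_nil.
rewrite big_cons; apply: measurableI.
  by apply: (E_sub j); apply: rA; rewrite mem_head.
by apply: ih => k kr; apply: rA; rewrite in_cons kr orbT.
Qed.

Lemma prob_rectangle_cons (j : I) (r : seq I) (A : I -> set T) : uniq (j :: r) ->
  (forall k, k \in j :: r -> E k (A k)) ->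
  prob Pr (\big[setI/setT]_(k <- j :: r) A k) =
  prob Pr (A j) * prob Pr (\big[setI/setT]_(k <- r) A k).
Proof.
move=> ujr rA; have ur : uniq r by case/andP: ujr.
have rA' k : k \in r -> E k (A k) by move=> kr; apply: rA; rewrite in_cons kr orbT.
apply: EFin_inj; rewrite EFinM -!probE//; try exact: measurable_rectangle.
  by rewrite !E_indep// big_cons.
by apply: (E_sub j); apply: rA; rewrite mem_head.
Qed.

(* Conditioning on one sample at a time, so that independence is used only
   through the product rule for rectangles. *)
Lemma prob_exp_markov (s r : seq I) (A : I -> set T) (c : R) : uniq (s ++ r) ->
  (forall j, j \in r -> E j (A j)) ->
  (forall j, j \in s -> forall v, prob Pr [set w | D j w = v] = q v) ->
  (forall j, j \in s -> forall w, (D j w < N)%N) ->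
  prob Pr ((\big[setI/setT]_(j <- r) A j) `&` [set w | c <= \sum_(j <- s) phi (D j w)])
  <= prob Pr (\big[setI/setT]_(j <- r) A j) *
     (expR (- c) * (\sum_(v < N) q v * expR (phi v)) ^+ size s).
Proof.
set M := \sum_(v < N) _.
have mS s' c' : measurable [set w | c' <= \sum_(j <- s') phi (D j w)].
  have := dmeas_map measurable (sigma_algebra_measurable T) D s' dmeas_sub.
  move=> /(_ [set u : seq nat | c' <= \sum_(v <- u) phi v]).
  rewrite (_ : _ @^-1` _ = [set w | c' <= \sum_(j <- s') phi (D j w)])//.
  by apply/seteqP; split => w /=; rewrite big_map.
elim: s r A c => [|j s ih] r A c usr rA Dq DN.
  have mA := measurable_rectangle _ _ rA.
  rewrite expr0 mulr1; have [c0|c0] := leP c 0.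
    apply: (@le_trans _ _ (prob Pr (\big[setI/setT]_(j <- r) A j))).
      by apply: prob_le => //; exact: measurableI.
    by rewrite ler_peMr ?prob_ge0// -expR0 ler_expR; lra.
  rewrite (_ : [set _ | _] = set0).
    by rewrite setI0 prob_set0 mulr_ge0 ?prob_ge0// expR_ge0.
  by apply/seteqP; split => w //=; rewrite big_nil leNgt c0.
have mA := measurable_rectangle _ _ rA.
have jr : j \notin r by move: usr; rewrite /= mem_cat negb_or -andbA => /and3P[].
rewrite (@prob_partition _ _ _ Pr _ (D j) N); first last.
- by move=> w _; apply: DN; rewrite mem_head.
- by move=> v; exact: (dmeas_sub j [set v]).
- exact: measurableI.
rewrite exprS.
rewrite [leRHS](_ : _ = \sum_(v < N) prob Pr (\big[setI/setT]_(k <- r) A k) * (q v *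
   (expR (phi v - c) * M ^+ size s))); last first.
  rewrite -mulr_sumr; congr (_ * _).
  rewrite mulrCA {1}/M mulr_suml; apply: eq_bigr => v _.
  by rewrite expRD; ring.
apply: ler_sum => v _.
pose A' k := if k == j then [set w | D j w = v] else A k.
have A'r : \big[setI/setT]_(k <- r) A' k = \big[setI/setT]_(k <- r) A k.
  by apply: eq_big_seq => k kr; rewrite /A' (negbTE (memPn jr k kr)).
have A'j : A' j = [set w | D j w = v] by rewrite /A' eqxx.
have rA' k : k \in j :: r -> E k (A' k).
  rewrite in_cons /A'; case: eqP => [-> _|_ /= kr]; last exact: rA.
  exact: (mD j [set (v : nat)]).
have usr' : uniq (s ++ j :: r).
  by rewrite uniq_catC/= mem_cat orbC -mem_cat uniq_catC.
have ujr : uniq (j :: r) by move: usr'; rewrite cat_uniq => /and3P[].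
have := ih (j :: r) A' (c - phi v) usr' rA' _ _.
rewrite prob_rectangle_cons// A'r A'j Dq ?mem_head// => h.
apply: le_trans (_ : _ <= q v * prob Pr (\big[setI/setT]_(k <- r) A k) *
   (expR (- (c - phi v)) * M ^+ size s)) _; last first.
  by rewrite opprB le_eqVlt; apply/orP; left; apply/eqP; ring.
apply: le_trans (h _ _).
- apply: prob_le.
  + by apply: measurableI; [exact: measurableI|exact: (dmeas_sub j [set (v : nat)])].
  + by apply: measurableI => //; exact: measurable_rectangle.
  + move=> w /= [[Aw]]; rewrite big_cons => cw Dv; split.
      by rewrite big_cons A'r; split => //; rewrite /A' eqxx.
    by rewrite -Dv lerBlDl.
- by move=> k ks; apply: Dq; rewrite in_cons ks orbT.
- by move=> k ks; apply: DN; rewrite in_cons ks orbT.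
Qed.

End ExponentialMoment.

End Concentration.

(** * The algorithm *)

Lemma absz_ceil_itv {R : realType} (a : R) : 0 <= a ->
  a <= `|Num.ceil a|%N%:R <= a + 1.
Proof.
move=> a0.
have c0 : 0 <= Num.ceil a by rewrite ceil_ge0//; apply: lt_le_trans a0; rewrite ltrN10.
rewrite natr_absz ger0_norm//; have /andP[h1 h2] := ceil_itv a.
by rewrite h2/=; move: h1; rewrite intrB; lra.
Qed.

Section Algorithm.
Context {R : realType} {n : nat}.
Variables (P : 'M[R]_n) (i : 'I_n) (eps alpha : R).
Hypotheses (P_stoch : stochastic P) (eps01 : 0 < eps < 1) (alpha01 : 0 < alpha < 1).
Implicit Types (x : nat -> nat -> nat -> 'I_n) (row : seq nat).

(* Lengths are recorded with threshold [theta k + 1], so that a sample is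
   truncated exactly when its entry is [theta k + 1]. *)
Definition sample_row x k : seq nat :=
  [seq walk_length i (theta k).+1 (x k s) | s <- iota 0 (num_samples i eps alpha x k)].

Definition row_mean k row : R := (\sum_(v <- row) (minn v (theta k))%:R) / (size row)%:R.

Definition row_trunc k row : R :=
  (\sum_(v <- row) ((theta k < v)%N : nat)%:R) / (size row)%:R.

Lemma size_sample_row x k : size (sample_row x k) = num_samples i eps alpha x k.
Proof. by rewrite size_map size_iota. Qed.

Lemma theta_gt0 k : (0 < theta k)%N.
Proof. by rewrite /theta expn_gt0. Qed.

Lemma thetaS k : theta k.+1 = (2 * theta k)%N.
Proof. by rewrite /theta expnS. Qed.

Lemma big_sample_row (F : nat -> R) x k :
  \sum_(v <- sample_row x k) F v =
  \sum_(s < num_samples i eps alpha x k) F (walk_length i (theta k).+1 (x k s)).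
Proof.
rewrite big_map -(big_mkord xpredT
  (fun s => F (walk_length i (theta k).+1 (x k s)))).
by rewrite /index_iota subn0.
Qed.

Lemma T_hatE x k : T_hat i eps alpha x k = row_mean k (sample_row x k).
Proof.
rewrite /T_hat /avg_length /row_mean size_sample_row big_sample_row.
by congr (_ / _); apply: eq_bigr => s _; rewrite -walk_length_minn ?theta_gt0.
Qed.

Lemma p_hatE x k : p_hat i eps alpha x k = row_trunc k (sample_row x k).
Proof.
rewrite /p_hat /row_trunc size_sample_row big_sample_row -natr_sum.
congr (_%:R / _); apply: eq_bigr => s _.
by rewrite hitting_time_gt ltn_walk_length// ltnSn.
Qed.

Lemma row_mean_ge0 k row : 0 <= row_mean k row.
Proof. by rewrite divr_ge0// sumr_ge0. Qed.

Lemma row_mean_le k row : row_mean k row <= (theta k)%:R.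
Proof.
rewrite /row_mean; case: row => [|v row]; first by rewrite big_nil mul0r.
rewrite ler_pdivrMr ?ltr0n// -natrM -natr_sum ler_nat.
rewrite (leq_trans (n := \sum_(u <- v :: row) theta k)%N)//.
  by apply: leq_sum => u _; exact: geq_minr.
by rewrite big_const_seq count_predT iter_addn_0.
Qed.

Lemma row_trunc_le k row : row_trunc k row * (theta k)%:R <= row_mean k row.
Proof.
rewrite /row_trunc /row_mean mulrAC ler_wpM2r ?invr_ge0// mulr_suml.
apply: ler_sum => v _; rewrite -natrM ler_nat.
by case: ltnP => /= h; rewrite ?mul0n ?mul1n.
Qed.

Definition tail_log k : R := ln (4 * (theta k)%:R / alpha).

Lemma tail_log_arg k : (0 < k)%N -> 8 < 4 * (theta k)%:R / alpha.
Proof.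
case: k => // k _; have /andP[a0 a1] := alpha01.
rewrite ltr_pdivlMr//; have : 1 <= (theta k)%:R :> R by rewrite ler1n theta_gt0.
by rewrite thetaS natrM; nra.
Qed.

Lemma expRN_tail_log k : expR (- tail_log k) = alpha / (4 * (theta k)%:R).
Proof.
have /andP[a0 a1] := alpha01; have : 0 < (theta k)%:R :> R by rewrite ltr0n theta_gt0.
move=> th0; rewrite expRN lnK ?posrE ?divr_gt0 ?mulr_gt0//.
by rewrite invf_div.
Qed.

Lemma tail_log_ge1 k : (0 < k)%N -> 1 <= tail_log k.
Proof.
move=> k0; have h := tail_log_arg k k0; have l2 := @ln2_ge R.
have : ln 8 <= tail_log k.
  by rewrite ler_ln ?posrE ?ltW//; apply: lt_trans h.
rewrite (_ : 8 = 2 ^+ 3 :> R); last by ring.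
by rewrite lnXn//; lra.
Qed.

Local Notation mu k := (mean_trunc P i (theta k)).

(** The first clause serves the mean length, the second the fraction of truncated samples. *)
Definition sample_ok k (m : nat) : Prop :=
  3 * (theta k)%:R * tail_log k <= m%:R * mu k * eps ^+ 2 /\
  6 * tail_log k <= m%:R * eps ^+ 2.

(* The lower deviation is cut to [9 / 10 * eps] so that the estimate stays
   bounded away from 0, relative to its mean, uniformly in [eps < 1]. *)
Definition row_good k row : Prop :=
  k = 0%N \/ (1 - 9 / 10 * eps) * mu k <= row_mean k row <= (1 + eps) * mu k.

Definition next_size k row : nat :=
  if k == 0%N then `|Num.ceil (6 * (1 + eps) * ln (8 / alpha) / eps ^+ 2)|%N
  else `|Num.ceil (3 * (1 + eps) * (theta k.+1)%:R * tail_log k.+1 /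
                   (row_mean k row * eps ^+ 2))|%N.

Lemma num_samplesS x k :
  num_samples i eps alpha x k.+1 = next_size k (sample_row x k).
Proof. by rewrite /next_size -T_hatE; case: k. Qed.

Lemma row_good_mean_gt0 k row : (0 < k)%N -> row_good k row -> 0 < row_mean k row.
Proof.
have /andP[e0 e1] := eps01; case: k => // k _ [//|/andP[h _]].
apply: lt_le_trans h; rewrite mulr_gt0//; first by lra.
by apply: lt_le_trans (mean_trunc_ge1 P i P_stoch _ (theta_gt0 k.+1)).
Qed.

(** The factor [1 + eps] in the sample size absorbs an overestimate of the mean. For the second
    clause, the mean is at most [theta k], half the new threshold, which turns the factor 3 into
    6. *)
Lemma next_size_ok k row : row_good k row -> sample_ok k.+1 (next_size k row).
Proof.
have /andP[e0 e1] := eps01; have e20 : 0 < eps ^+ 2 by rewrite exprn_gt0.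
have L1 := tail_log_ge1 k.+1 isT.
have mu1 := mean_trunc_ge1 P i P_stoch _ (theta_gt0 k.+1).
case: k L1 mu1 => [|k] L1 mu1 h; rewrite /next_size/=.
  have -> : ln (8 / alpha) = tail_log 1.
    by rewrite /tail_log /theta expn1; congr (ln (_ / _)); ring.
  have a0 : 0 <= 6 * (1 + eps) * tail_log 1 / eps ^+ 2.
    by rewrite divr_ge0 ?ltW// !mulr_gt0//; lra.
  have /andP[+ _] := absz_ceil_itv _ a0.
  rewrite ler_pdivrMr// => hm; rewrite /sample_ok [theta 1]expn1.
  move: hm; set m := (`|_|%N)%:R => hm.
  have m0 : 0 <= m by [].
  have h6 : 6 * tail_log 1 <= m * eps ^+ 2 by nra.
  split => //; rewrite [leRHS]mulrAC; apply: (@le_trans _ _ (m * eps ^+ 2)); first by lra.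
  by apply: ler_peMr => //; rewrite mulr_ge0// ltW.
have t0 := row_good_mean_gt0 k.+1 row isT h.
have tle := row_mean_le k.+1 row.
case: h => // /andP[_ hle].
have muS : mu k.+1 <= mu k.+2 by apply: mean_trunc_le; rewrite // (thetaS k.+1) leq_pmull.
have thp : 0 < (theta k.+1)%:R :> R by rewrite ltr0n theta_gt0.
have a0 : 0 <= 3 * (1 + eps) * (theta k.+2)%:R * tail_log k.+2 / (row_mean k.+1 row * eps ^+ 2).
  by rewrite divr_ge0 ?(ltW (mulr_gt0 t0 e20))// !mulr_ge0//; lra.
have /andP[+ _] := absz_ceil_itv _ a0.
rewrite ler_pdivrMr; last exact: mulr_gt0.
rewrite /sample_ok; set m := (`|_|%N)%:R => hm.
have m0 : 0 <= m by [].
move: hm; rewrite {1}(thetaS k.+1) natrM => hm.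
have e1p : 0 < 1 + eps by lra.
split.
  rewrite (thetaS k.+1) -(ler_pM2l e1p).
  apply: (@le_trans _ _ (m * (row_mean k.+1 row * eps ^+ 2))); first by lra.
  rewrite [leRHS](_ : _ = m * ((1 + eps) * mu k.+2 * eps ^+ 2)); last by rewrite -thetaS; ring.
  rewrite ler_wpM2l// ler_wpM2r ?(ltW e20)//; apply: le_trans hle _.
  by rewrite ler_wpM2l// (ltW e1p).
rewrite -(ler_pM2l thp).
apply: (@le_trans _ _ (m * (row_mean k.+1 row * eps ^+ 2))).
  apply: le_trans hm; rewrite -subr_ge0.
  rewrite (_ : _ - _ = 6 * (eps * (theta k.+1)%:R * tail_log k.+2)); last by ring.
  by rewrite !mulr_ge0// ltW//; lra.
rewrite [leRHS](_ : _ = m * ((theta k.+1)%:R * eps ^+ 2)); last by ring.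
by rewrite ler_wpM2l// ler_wpM2r ?(ltW e20).
Qed.

End Algorithm.

Lemma dmeas_walk_length {T : Type} {n : nat} (S : set (set T)) (i : 'I_n) (th : nat)
    (Y : nat -> T -> 'I_n) : sigma_algebra setT S -> (forall t, dmeas S (Y t)) ->
  dmeas S (fun w => walk_length i th (Y^~ w)).
Proof.
move=> S_sigma mY; rewrite /walk_length; elim: (iota 1 th) => [|t s ih] /=.
  exact: dmeas_cst.
apply: (@dmeas_bind _ S S_sigma _ _ (Y t) (fun y w =>
  head th (if (t == th) || (y == i) then
    t :: [seq t0 <- s | (t0 == th) || (Y t0 w == i)]
    else [seq t0 <- s | (t0 == th) || (Y t0 w == i)]))) => // y.
by case: ((t == th) || (y == i)) => //=; exact: dmeas_cst.
Qed.

Lemma minn_sum_ltn (v th : nat) : minn v th = (\sum_(0 <= t < th) (t < v))%N.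
Proof.
have -> : (\sum_(0 <= t < th) (t < v) = \sum_(0 <= t < th | (t < v)%N) 1)%N.
  by rewrite [RHS]big_mkcond; apply: eq_bigr => t _; case: ltnP.
rewrite sum1_count /index_iota subn0; elim: th => [|th ih]; first by rewrite minn0.
by rewrite -[in RHS]addn1 iotaD count_cat -ih/= add0n; lia.
Qed.

(** * Adaptive sample sizes and conditioning on the past *)

Section History.
Context {d : measure_display} {T : measurableType d} {R : realType} {n : nat}.
Variables (Pr : probability T R) (P : 'M[R]_n) (i : 'I_n) (eps alpha : R).
Variable X : nat -> nat -> nat -> T -> 'I_n.
Hypotheses (P_stoch : stochastic P) (eps01 : 0 < eps < 1) (alpha01 : 0 < alpha < 1).
Hypothesis X_chain : forall k s, markov_chain Pr P i (X k s).
Hypothesis X_indep : independent_processes Pr (fun ks : nat * nat => X ks.1 ks.2).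

Local Notation path w := (fun k s t => X k s t w).
Local Notation row k w := (sample_row i eps alpha (path w) k).

Let E (j : nat * nat) : set (set T) := path_events (X j.1 j.2).
Let D (j : nat * nat) (w : T) : nat :=
  walk_length i (theta j.1).+1 (fun t => X j.1 j.2 t w).

Lemma E_sigma j : sigma_algebra setT (E j).
Proof. exact: smallest_sigma_algebra. Qed.

Lemma E_sub j : E j `<=` measurable.
Proof.
apply: smallest_sub; first exact: sigma_algebra_measurable.
by move=> _ [t [x ->]]; case: (X_chain j.1 j.2).
Qed.

Lemma dmeas_sample j : dmeas (E j) (D j).
Proof.
apply: dmeas_walk_length => [|t]; first exact: E_sigma.
apply: dmeas_singletons; first exact: E_sigma.
by move=> v; apply: sub_sigma_algebra; exists t, v.
Qed.

Lemma E_indep (s : seq (nat * nat)) (A : nat * nat -> set T) :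
  uniq s -> (forall j, j \in s -> E j (A j)) ->
  Pr (\big[setI/setT]_(j <- s) A j) = (\prod_(j <- s) Pr (A j))%E.
Proof. exact: X_indep. Qed.

Let dmeas_sampleT := dmeas_sub E D E_sub dmeas_sample.

Lemma sample_rowE k w :
  row k w = [seq D (k, s) w | s <- iota 0 (num_samples i eps alpha (path w) k)].
Proof. by []. Qed.

Lemma sample_rowS k w :
  row k.+1 w = [seq D (k.+1, s) w | s <- iota 0 (next_size eps alpha k (row k w))].
Proof. by rewrite sample_rowE num_samplesS. Qed.

Lemma dmeas_row k : dmeas measurable (fun w => row k w).
Proof.
elim: k => [|k ih].
  by apply: dmeas_cst; exact: sigma_algebra_measurable.
have -> : (fun w => row k.+1 w) = (fun w => (fun r w =>
    [seq D (k.+1, s) w | s <- iota 0 (next_size eps alpha k r)]) (row k w) w).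
  by apply/funext => w; rewrite sample_rowS.
apply: (dmeas_bind measurable (sigma_algebra_measurable T) (fun w => row k w) (fun r w =>
    [seq D (k.+1, s) w | s <- iota 0 (next_size eps alpha k r)])) => // r.
apply: (dmeas_map _ _ (fun s => D (k.+1, s))) => [|s].
  exact: sigma_algebra_measurable.
exact: dmeas_sampleT.
Qed.

(** All rows are kept, latest first: with the latest row alone prescribed, the earlier estimates
    that fixed its size would remain random and the event would not be a rectangle. *)
Fixpoint history (k : nat) (w : T) : seq (seq nat) :=
  if k is k'.+1 then row k w :: history k' w else [::].

Lemma head_history k w : head [::] (history k w) = row k w.
Proof. by case: k. Qed.

Lemma dmeas_history k : dmeas measurable (history k).
Proof.
elim: k => [|k ih] /=; first by apply: dmeas_cst; exact: sigma_algebra_measurable.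
apply: (dmeas_bind2 measurable (sigma_algebra_measurable T) (fun w => row k.+1 w)
  (history k) cons) => //.
exact: dmeas_row.
Qed.

Lemma map_eq_nth (f : nat -> nat) (v : seq nat) :
  [seq f s | s <- iota 0 (size v)] = v <-> forall s, s \in iota 0 (size v) -> f s = nth 0%N v s.
Proof.
split=> [vE s|h].
  by rewrite mem_iota/= => sv; rewrite -[in RHS]vE (nth_map 0%N) ?size_iota// nth_iota.
apply: (@eq_from_nth _ 0%N); rewrite size_map size_iota// => s sv.
by rewrite (nth_map 0%N) ?size_iota// nth_iota// h// mem_iota.
Qed.

Lemma bigsetI_seqE {I : eqType} (r : seq I) (A : I -> set T) :
  \big[setI/setT]_(j <- r) A j = [set w | forall j, j \in r -> A j w].
Proof.
elim: r => [|j r ih]; first by rewrite big_nil; apply/seteqP; split.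
rewrite big_cons ih; apply/seteqP; split => w /=.
  by move=> [Aj h] k; rewrite in_cons => /predU1P[->//|]; exact: h.
by move=> h; split=> [|k kr]; apply: h; rewrite in_cons ?eqxx// kr orbT.
Qed.

(* Prescribing the history prescribes the sample sizes, hence only finitely
   many fixed samples. *)
Lemma history_event k h :
  [set w | history k w = h] = set0 \/
  exists (r : seq (nat * nat)) (A : nat * nat -> set T),
    [/\ uniq r, forall j, j \in r -> (j.1 <= k)%N, forall j, j \in r -> E j (A j) &
        [set w | history k w = h] = \big[setI/setT]_(j <- r) A j].
Proof.
elim: k h => [|k ih] [|v h].
- right; exists [::], (fun=> setT); split=> //; rewrite big_nil.
  by apply/seteqP; split.
- by left; apply/seteqP; split.
- by left; apply/seteqP; split.
have [h0|[r [A [ur rk rA hE]]]] := ih h.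
  by left; apply/seteqP; split=> w //= [_ hw]; rewrite -[False]/(set0 w) -h0.
pose m := next_size eps alpha k (head [::] h).
have hist_m w : history k w = h -> row k.+1 w = [seq D (k.+1, s) w | s <- iota 0 m].
  by move=> hw; rewrite sample_rowS -head_history hw.
have [vm|vm] := eqVneq (size v) m; last first.
  left; apply/seteqP; split=> w //= [rw hw]; move/eqP: vm; apply.
  by rewrite -rw hist_m// size_map size_iota.
right; exists ([seq (k.+1, s) | s <- iota 0 m] ++ r).
exists (fun j => if j.1 == k.+1 then [set w | D j w = nth 0%N v j.2] else A j).
have rk1 j : j \in r -> (j.1 == k.+1) = false by move/rk; lia.
split.
- rewrite cat_uniq ur andbT map_inj_uniq ?iota_uniq/=; last by move=> s1 s2 [].
  by apply/hasPn => j /rk1; apply: contraFN => /mapP[s _ ->]/=.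
- by move=> j; rewrite mem_cat => /orP[/mapP[s _ ->]//|/rk]; lia.
- move=> j; rewrite mem_cat => /orP[/mapP[s _ ->]/=|jr].
    by rewrite eqxx; exact: (dmeas_sample (k.+1, s) [set nth 0%N v s]).
  by rewrite rk1//; exact: rA.
rewrite bigsetI_seqE; move: hE; rewrite bigsetI_seqE => hE.
have hEw w : history k w = h <-> forall j, j \in r -> A j w.
  by rewrite -[X in X <-> _]/([set w | history k w = h] w) hE.
apply/seteqP; split=> w /=.
  move=> [rw hw] j; rewrite mem_cat => /orP[/mapP[s sm ->]/=|jr].
    rewrite eqxx; rewrite (hist_m _ hw) -vm in rw.
    by rewrite -vm in sm; exact: (iffLR (map_eq_nth _ _) rw).
  by rewrite rk1//; exact: (iffLR (hEw w) hw).
move=> H; have hw : history k w = h.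
  by apply/hEw => j jr; have := H j; rewrite mem_cat jr orbT rk1//; exact.
rewrite hw hist_m//; congr (_ :: _); rewrite -vm; apply/map_eq_nth => s; rewrite vm => sm.
by have := H (k.+1, s); rewrite mem_cat map_f//= eqxx; exact.
Qed.

Definition sample_law k (v : nat) : R := prob Pr [set w | D (k, 0%N) w = v].

Lemma prob_sample_gt j t : (t <= theta j.1)%N ->
  prob Pr [set w | (t < D j w)%N] = hit_tail P i t i.
Proof.
move=> tj; rewrite -(prob_avoids Pr P i i _ (X_chain j.1 j.2) t); congr (prob Pr _).
by apply/seteqP; split => w /=; rewrite /D ltn_walk_length// ltnS tj.
Qed.

(** The tails agree up to the threshold by the Markov property, and beyond it both vanish. *)
Lemma sample_lawE k s v : prob Pr [set w | D (k, s) w = v] = sample_law k v.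
Proof.
apply: prob_eq_tails; [exact: dmeas_sampleT|exact: dmeas_sampleT|move=> t].
have [tk|tk] := leqP t (theta k); first by rewrite !prob_sample_gt.
by congr (prob Pr _); apply/seteqP; split=> w /=; rewrite /D ltn_walk_length// ltnS leqNgt tk.
Qed.

Lemma sample_lt j w : (D j w < (theta j.1).+2)%N.
Proof. by rewrite ltnS; exact: walk_length_le. Qed.

Lemma sample_law_ge0 k v : 0 <= sample_law k v.
Proof. exact: prob_ge0. Qed.

Lemma sample_law_sum_gt k t : (t <= theta k)%N ->
  \sum_(v < (theta k).+2) sample_law k v * ((t < v)%N : nat)%:R = hit_tail P i t i.
Proof.
move=> tk; rewrite -(prob_sample_gt (k, 0%N)%N t tk).
have mD v : measurable [set w | D (k, 0%N) w = v] by exact: (dmeas_sampleT (k, 0%N) [set v]).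
rewrite (prob_partition Pr _ (D (k, 0%N)) (theta k).+2)//; last by move=> *; exact: sample_lt.
  apply: eq_bigr => v _; case: ltnP => tv; rewrite ?mulr1 ?mulr0 /sample_law.
    congr (prob Pr _); apply/seteqP; split => w /=; [by move=> ->|by case].
  rewrite (_ : _ `&` _ = set0) ?prob_set0//.
  by apply/seteqP; split=> w //= [] /[swap] ->; rewrite ltnNge tv.
exact: (dmeas_sampleT (k, 0%N) [set v | (t < v)%N]).
Qed.

Lemma sample_law_sum k : \sum_(v < (theta k).+2) sample_law k v = 1.
Proof.
have mD v : measurable [set w | D (k, 0%N) w = v] by exact: (dmeas_sampleT (k, 0%N) [set v]).
have <- : prob Pr setT = 1 by rewrite /prob probability_setT.
rewrite (prob_partition Pr _ (D (k, 0%N)) (theta k).+2)//; last by move=> *; exact: sample_lt.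
by apply: eq_bigr => v _; rewrite setTI.
Qed.

Lemma sample_law_mean k :
  \sum_(v < (theta k).+2) sample_law k v * (minn v (theta k))%:R = mean_trunc P i (theta k).
Proof.
under eq_bigr do rewrite minn_sum_ltn natr_sum mulr_sumr.
rewrite exchange_big/= /mean_trunc !big_nat; apply: eq_bigr => t /andP[_ tk].
by rewrite sample_law_sum_gt// ltnW.
Qed.

(** One exponential bound for all failure events. The threshold [c] is a function of the sample
    size, which becomes a constant once the history is prescribed; the history also decides whether
    row [k] is good, and a good one supplies [sample_ok]. *)
Lemma prob_step_le k (phi : nat -> R) (c : nat -> R) (B : set T) (b : R) :
  measurable B -> 0 <= b ->
  (forall w, B w -> row_good P i eps k (row k w) /\
     c (size (row k.+1 w)) <= \sum_(v <- row k.+1 w) phi v) ->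
  (forall m, sample_ok P i eps alpha k.+1 m -> expR (- c m) *
     (\sum_(v < (theta k.+1).+2) sample_law k.+1 v * expR (phi v)) ^+ m <= b) ->
  prob Pr B <= b.
Proof.
move=> mB b0 Bc cb.
apply: (prob_le_conditional Pr (history k)) => //; first exact: dmeas_history.
move=> h; have mh : measurable [set w | history k w = h].
  exact: (dmeas_history k [set h]).
have [h0|[r [A [ur rk rA hE]]]] := history_event k h.
  by rewrite h0 set0I prob_set0 mul0r.
have [gh|ngh] := pselect (row_good P i eps k (head [::] h)); last first.
  rewrite (_ : _ `&` B = set0) ?prob_set0 ?mulr_ge0 ?prob_ge0//.
  by apply/seteqP; split=> w //= [hw /Bc[+ _]]; rewrite -head_history hw.
pose m := next_size eps alpha k (head [::] h).
pose s := [seq (k.+1, s) | s <- iota 0 m].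
have sm : size s = m by rewrite size_map size_iota.
have okm : sample_ok P i eps alpha k.+1 m by exact: next_size_ok.
have rowE w : history k w = h -> row k.+1 w = [seq D j w | j <- s].
  by move=> hw; rewrite sample_rowS -head_history hw -map_comp.
have mS : measurable [set w | c m <= \sum_(j <- s) phi (D j w)].
  have := dmeas_map measurable (sigma_algebra_measurable T) D s dmeas_sampleT.
  move=> /(_ [set u : seq nat | c m <= \sum_(v <- u) phi v]).
  rewrite (_ : _ @^-1` _ = [set w | c m <= \sum_(j <- s) phi (D j w)])//.
  by apply/seteqP; split => w /=; rewrite big_map.
apply: le_trans (_ : _ <= prob Pr ([set w | history k w = h] `&`
    [set w | c m <= \sum_(j <- s) phi (D j w)])) _.
  apply: prob_le; [exact: measurableI|exact: measurableI|].
  move=> w /= [hw /Bc[_]]; rewrite rowE// size_map sm big_map => cw; split => //.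
rewrite hE; apply: le_trans (prob_exp_markov Pr E D (theta k.+1).+2 (sample_law k.+1) phi
  E_sub E_indep dmeas_sample s r A (c m) _ rA _ _) _.
- rewrite cat_uniq ur andbT map_inj_uniq ?iota_uniq/=; last by move=> s1 s2 [].
  by apply/hasPn => j /rk jk; apply/mapP => -[t _ jt]; move: jk; rewrite jt ltnn.
- by move=> j /mapP[t _ ->] v; exact: sample_lawE.
- by move=> j /mapP[t _ ->] w; exact: sample_lt.
by rewrite ler_wpM2l ?prob_ge0// sm cb.
Qed.

End History.

(** * Concentration of all estimates *)

Lemma exp_moment_le {R : realType} (M a c L : R) (m : nat) :
  0 <= M <= expR a -> m%:R * (a - c) <= - L ->
  expR (- (m%:R * c)) * M ^+ m <= expR (- L).
Proof.
move=> /andP[M0 Ma] h; apply: (@le_trans _ _ (expR (- (m%:R * c)) * expR a ^+ m)).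
  by rewrite ler_wpM2l ?expR_ge0// lerXn2r ?nnegrE ?expR_ge0.
by rewrite -expRM_natl -expRD ler_expR; lra.
Qed.

Lemma size_row_mean {R : realType} k r :
  (size r)%:R * row_mean k r = \sum_(v <- r) (minn v (theta k))%:R :> R.
Proof.
rewrite /row_mean; case: r => [|v r]; first by rewrite big_nil !mul0r.
by rewrite mulrC divfK ?pnatr_eq0.
Qed.

Lemma size_row_trunc {R : realType} k r :
  (size r)%:R * row_trunc k r = \sum_(v <- r) ((theta k < v)%N : nat)%:R :> R.
Proof.
rewrite /row_trunc; case: r => [|v r]; first by rewrite big_nil !mul0r.
by rewrite mulrC divfK ?pnatr_eq0.
Qed.

Section GoodEvent.
Context {d : measure_display} {T : measurableType d} {R : realType} {n : nat}.
Variables (Pr : probability T R) (P : 'M[R]_n) (i : 'I_n) (eps alpha : R).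
Variable X : nat -> nat -> nat -> T -> 'I_n.
Hypotheses (P_stoch : stochastic P) (eps01 : 0 < eps < 1) (alpha01 : 0 < alpha < 1).
Hypothesis X_chain : forall k s, markov_chain Pr P i (X k s).
Hypothesis X_indep : independent_processes Pr (fun ks : nat * nat => X ks.1 ks.2).

Local Notation path w := (fun k s t => X k s t w).
Local Notation row k w := (sample_row i eps alpha (path w) k).
Local Notation mu k := (mean_trunc P i (theta k)).
Local Notation tail k := (hit_tail P i (theta k) i).
Local Notation good k w := (row_good P i eps k (row k w)).

(** Like the three events after it, this one includes the goodness of row [k], without which the
    next sample may be too small for a Chernoff bound. *)
Definition mean_high k : set T :=
  [set w | good k w /\ (1 + eps) * mu k.+1 < row_mean k.+1 (row k.+1 w)].
Definition mean_low k : set T :=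
  [set w | good k w /\ row_mean k.+1 (row k.+1 w) < (1 - 9 / 10 * eps) * mu k.+1].
Definition trunc_low k : set T :=
  [set w | good k w /\ (eps <= tail k.+1 /\ row_trunc k.+1 (row k.+1 w) < 2 * eps / 3)].
Definition trunc_high k : set T :=
  [set w | good k w /\ (tail k.+1 <= eps / 12 /\ 2 * eps / 3 <= row_trunc k.+1 (row k.+1 w))].

Lemma measurable_rows k (p q : seq nat -> Prop) :
  measurable [set w | p (row k w) /\ q (row k.+1 w)].
Proof.
apply: dmeas_set; apply: dmeas_and; first exact: sigma_algebra_measurable.
  by apply: dmeas_comp; exact: dmeas_row X_chain _.
by apply: dmeas_comp; exact: dmeas_row X_chain _.
Qed.

Lemma measurable_mean_high k : measurable (mean_high k).
Proof.
exact: (measurable_rows k (row_good P i eps k)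
  (fun r => is_true ((1 + eps) * mu k.+1 < row_mean k.+1 r))).
Qed.

Lemma measurable_mean_low k : measurable (mean_low k).
Proof.
exact: (measurable_rows k (row_good P i eps k)
  (fun r => is_true (row_mean k.+1 r < (1 - 9 / 10 * eps) * mu k.+1))).
Qed.

Lemma measurable_trunc_low k : measurable (trunc_low k).
Proof.
exact: (measurable_rows k (row_good P i eps k)
  (fun r => eps <= tail k.+1 /\ row_trunc k.+1 r < 2 * eps / 3)).
Qed.

Lemma measurable_trunc_high k : measurable (trunc_high k).
Proof.
exact: (measurable_rows k (row_good P i eps k)
  (fun r => tail k.+1 <= eps / 12 /\ 2 * eps / 3 <= row_trunc k.+1 r)).
Qed.

Let law k := sample_law Pr i X k.
Let step_le := prob_step_le Pr P i eps alpha X P_stoch eps01 alpha01 X_chain X_indep.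

Lemma law_moment_le k (y : nat -> R) (s p : R) : (forall v, 0 <= y v <= 1) ->
  \sum_(v < (theta k).+2) law k v * y v = p ->
  0 <= \sum_(v < (theta k).+2) law k v * expR (s * y v) <= 1 + p * (expR s - 1).
Proof.
move=> y01 <-; apply/andP; split.
  by apply: sumr_ge0 => v _; rewrite mulr_ge0 ?sample_law_ge0 ?expR_ge0.
apply: mgf_le => //; first by move=> v; exact: sample_law_ge0.
exact: sample_law_sum X_chain _.
Qed.

Lemma thetaR_gt0 k : 0 < (theta k)%:R :> R.
Proof. by rewrite ltr0n theta_gt0. Qed.

Lemma law_mean k :
  \sum_(v < (theta k).+2) law k v * ((minn v (theta k))%:R / (theta k)%:R) =
  mu k / (theta k)%:R.
Proof.
rewrite -(sample_law_mean Pr P i X X_chain) mulr_suml.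
by apply: eq_bigr => v _; rewrite mulrA.
Qed.

Lemma minn_ratio_itv k v : 0 <= ((minn v (theta k))%:R / (theta k)%:R : R) <= 1.
Proof.
by rewrite divr_ge0//= ler_pdivrMr ?thetaR_gt0// mul1r ler_nat geq_minr.
Qed.

Lemma bool_itv (b : bool) : 0 <= ((b : nat)%:R : R) <= 1.
Proof. by case: b; rewrite ?lexx ler01. Qed.

(** Lengths divided by the threshold lie in [[0, 1]] with mean [mu k / theta k]; both tail exponents
    yield [eps^2 / 3] per unit of that mean. *)
Lemma ratio_sample_ok k m : sample_ok P i eps alpha k m ->
  tail_log alpha k <= m%:R * (mu k / (theta k)%:R * (eps ^+ 2 / 3)).
Proof.
move=> [h _]; have t0 := thetaR_gt0 k.
rewrite (_ : _ * _ = m%:R * mu k * eps ^+ 2 / (3 * (theta k)%:R)); last first.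
  by field; rewrite gt_eqF.
by rewrite ler_pdivlMr ?mulr_gt0//; lra.
Qed.

Lemma sum_minn_ratio k (s : R) r : \sum_(v <- r) s * ((minn v (theta k))%:R / (theta k)%:R) =
  (size r)%:R * (s / (theta k)%:R * row_mean k r).
Proof.
rewrite mulrCA size_row_mean mulr_sumr; apply: eq_bigr => v _.
by rewrite mulrA mulrAC.
Qed.

Lemma sum_trunc k (s : R) r : \sum_(v <- r) s * ((theta k < v)%N : nat)%:R =
  (size r)%:R * (s * row_trunc k r).
Proof. by rewrite mulrCA size_row_trunc mulr_sumr. Qed.

Lemma mu_gt0 k : 0 < mu k.
Proof. by apply: lt_le_trans (mean_trunc_ge1 P i P_stoch _ (theta_gt0 k)). Qed.

Lemma prob_mean_high k : prob Pr (mean_high k) <= expR (- tail_log alpha k.+1).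
Proof.
have /andP[e0 e1] := eps01; have t0 := thetaR_gt0 k.+1; have m0 := mu_gt0 k.+1.
pose p := mu k.+1 / (theta k.+1)%:R; have p0 : 0 < p by rewrite divr_gt0.
apply: (step_le k (fun v => 2 * eps / 3 * ((minn v (theta k.+1))%:R / (theta k.+1)%:R))
  (fun m => m%:R * (2 * eps / 3 * (1 + eps) * p))); rewrite ?expR_ge0//.
- exact: measurable_mean_high.
- move=> w [gw hw]; split=> //; rewrite sum_minn_ratio ler_wpM2l//.
  rewrite (_ : _ * p = 2 * eps / 3 / (theta k.+1)%:R * ((1 + eps) * mu k.+1)).
    by rewrite ler_wpM2l ?(ltW hw)// !divr_ge0 ?mulr_ge0 ?ltW.
  by rewrite /p; field; rewrite gt_eqF.
move=> m okm; have /andP[M0 M1] := law_moment_le k.+1 _ (2 * eps / 3) _ (minn_ratio_itv k.+1) (law_mean k.+1).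
apply: (@exp_moment_le _ _ (p * (expR (2 * eps / 3) - 1))).
  by rewrite M0/=; apply: le_trans M1 (expR_ge1Dx _).
have := ratio_sample_ok _ _ okm; have := upper_tail_exponent _ _ eps01; rewrite -/p.
set a := expR _; set L := tail_log _ _ => h1 h2.
rewrite -[leRHS]opprK opprK lerNr; apply: le_trans h2 _.
rewrite -mulrN ler_wpM2l// [leRHS](_ : _ = p * - (a - 1 - 2 * eps / 3 * (1 + eps))); last by ring.
by rewrite ler_pM2l//; lra.
Qed.

Lemma prob_mean_low k : prob Pr (mean_low k) <= expR (- tail_log alpha k.+1).
Proof.
have /andP[e0 e1] := eps01; have t0 := thetaR_gt0 k.+1; have m0 := mu_gt0 k.+1.
pose p := mu k.+1 / (theta k.+1)%:R; have p0 : 0 < p by rewrite divr_gt0.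
apply: (step_le k (fun v => - (9 / 10 * eps) * ((minn v (theta k.+1))%:R / (theta k.+1)%:R))
  (fun m => m%:R * (- (9 / 10 * eps) * (1 - 9 / 10 * eps) * p))); rewrite ?expR_ge0//.
- exact: measurable_mean_low.
- move=> w [gw hw]; split=> //; rewrite sum_minn_ratio ler_wpM2l//.
  rewrite (_ : _ * p = - (9 / 10 * eps) / (theta k.+1)%:R * ((1 - 9 / 10 * eps) * mu k.+1)).
    rewrite ler_wnM2l ?(ltW hw)// pmulr_lle0 ?invr_gt0//; lra.
  by rewrite /p; field; rewrite gt_eqF.
move=> m okm; have /andP[M0 M1] := law_moment_le k.+1 _ (- (9 / 10 * eps)) _ (minn_ratio_itv k.+1) (law_mean k.+1).
apply: (@exp_moment_le _ _ (p * (expR (- (9 / 10 * eps)) - 1))).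
  by rewrite M0/=; apply: le_trans M1 (expR_ge1Dx _).
have := ratio_sample_ok _ _ okm; have := lower_tail_exponent _ _ eps01; rewrite -/p.
set a := expR _; set L := tail_log _ _ => h1 h2.
rewrite -[leRHS]opprK opprK lerNr; apply: le_trans h2 _.
rewrite -mulrN ler_wpM2l// [leRHS](_ : _ = p * - (a - 1 + 9 / 10 * eps * (1 - 9 / 10 * eps))); last by ring.
by rewrite ler_pM2l//; lra.
Qed.

Lemma prob_trunc_low k : prob Pr (trunc_low k) <= expR (- tail_log alpha k.+1).
Proof.
have /andP[e0 e1] := eps01.
have [pe|pe] := leP eps (tail k.+1); last first.
  rewrite (_ : trunc_low k = set0) ?prob_set0 ?expR_ge0//.
  by apply/seteqP; split=> w // [_ [h _]]; move: pe; rewrite ltNge h.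
apply: (step_le k (fun v => - eps * ((theta k.+1 < v)%N : nat)%:R)
  (fun m => m%:R * (- eps * (2 * eps / 3)))); rewrite ?expR_ge0//.
- exact: measurable_trunc_low.
- move=> w [gw [_ hw]]; split=> //; rewrite sum_trunc ler_wpM2l// ler_wnM2l ?(ltW hw)//; lra.
move=> m [_ okm]; have /andP[M0 M1] := law_moment_le k.+1 _ (- eps) _ (fun v => bool_itv (theta k.+1 < v)%N)
  (sample_law_sum_gt Pr P i X X_chain k.+1 _ (leqnn _)).
(* Against the threshold [2 eps / 3], tilt [- eps] leaves [5/6 - 2/3 = 1/6] of [eps^2] per sample,
   matching the 6 in [sample_ok]. *)
apply: (@exp_moment_le _ _ (- (5 / 6 * eps ^+ 2))).
  rewrite M0/=; apply: le_trans M1 _; apply: le_trans (truncation_tail_exponent _ _ eps01).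
  rewrite -[leRHS]/(1 - _) lerD2l -[leLHS]opprK lerN2 -mulrN opprB ler_wpM2r//.
  by rewrite subr_ge0 expR_le1; lra.
by nra.
Qed.

(** With tilt 1 each sample contributes at least [2 eps / 3 - eps / 6 = eps / 2], which gives three
    times the usual exponent; the surplus pays for the factor [1/4]. *)
Lemma prob_trunc_high k : prob Pr (trunc_high k) <= expR (- tail_log alpha k.+1) / 4.
Proof.
have /andP[e0 e1] := eps01; have L1 := tail_log_ge1 _ alpha01 k.+1 isT.
(* The cubic bound at 1 reads [1/3 <= expR (- 1)]. *)
have e3 : expR 1 <= 3 :> R.
  have := @expRN_ge3 R 1 ler01; rewrite expRN.
  have h : 0 < expR 1 :> R by rewrite expR_gt0.
  rewrite -[X in _ <= X]div1r ler_pdivlMr//; lra.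
apply: (@le_trans _ _ (expR (- (3 * tail_log alpha k.+1)))); last first.
  rewrite (_ : - (3 * _) = - tail_log alpha k.+1 - 2 * tail_log alpha k.+1); last by ring.
  rewrite expRD ler_wpM2l ?expR_ge0//.
  apply: (@le_trans _ _ (expR (- 2))); first by rewrite ler_expR; lra.
  rewrite expRN lef_pV2 ?posrE ?expR_gt0//.
  rewrite (_ : 2 = 1 + 1 :> R)// expRD; have := @expR_ge1Dx R 1; nra.
have [pe|pe] := leP (tail k.+1) (eps / 12); last first.
  rewrite (_ : trunc_high k = set0) ?prob_set0 ?expR_ge0//.
  by apply/seteqP; split=> w // [_ [h _]]; move: pe; rewrite ltNge h.
apply: (step_le k (fun v => 1 * ((theta k.+1 < v)%N : nat)%:R)
  (fun m => m%:R * (1 * (2 * eps / 3)))); rewrite ?expR_ge0//.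
- exact: measurable_trunc_high.
- by move=> w [gw [_ hw]]; split=> //; rewrite sum_trunc ler_wpM2l// ler_wpM2l.
move=> m [_ okm]; have /andP[M0 M1] := law_moment_le k.+1 _ 1 _ (fun v => bool_itv (theta k.+1 < v)%N)
  (sample_law_sum_gt Pr P i X X_chain k.+1 _ (leqnn _)).
apply: (@exp_moment_le _ _ (eps / 6)).
  rewrite M0/=; apply: le_trans M1 (le_trans (expR_ge1Dx _) _); rewrite ler_expR.
  have := hit_tail_ge0 P i P_stoch (theta k.+1) i; nra.
have m0 : 0 <= m%:R :> R by [].
by nra.
Qed.

Definition bad k : set T := mean_high k `|` mean_low k `|` trunc_low k `|` trunc_high k.

Lemma measurable_bad k : measurable (bad k).
Proof.
apply: measurableU; last exact: measurable_trunc_high.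
apply: measurableU; last exact: measurable_trunc_low.
by apply: measurableU; [exact: measurable_mean_high|exact: measurable_mean_low].
Qed.

(** Three events cost [1/4] each and the fourth [1/16], in units of [alpha / 2^(k+1)]. *)
Lemma prob_bad k : prob Pr (bad k) <= 13 / 16 * alpha * 2^-1 ^+ k.+1.
Proof.
have h1 := prob_mean_high k; have h2 := prob_mean_low k.
have h3 := prob_trunc_low k; have h4 := prob_trunc_high k.
have m1 := measurable_mean_high k.
have m2 := measurable_mean_low k.
have m3 := measurable_trunc_low k.
have m4 := measurable_trunc_high k.
have m12 := measurableU _ _ m1 m2; have m123 := measurableU _ _ m12 m3.
have u1 := probU_le Pr _ _ m1 m2; have u2 := probU_le Pr _ _ m12 m3.
have u3 := probU_le Pr _ _ m123 m4.
have E : expR (- tail_log alpha k.+1) = alpha * 2^-1 ^+ k.+1 / 4.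
  have th0 := thetaR_gt0 k.+1.
  by rewrite expRN_tail_log// exprVn -natrX -/(theta _); field; rewrite gt_eqF.
by rewrite /bad; rewrite E in h1 h2 h3 h4; lra.
Qed.

Definition all_good : set T :=
  [set w | forall k, (0 < k)%N -> [/\ good k w,
     eps <= tail k -> 2 * eps / 3 <= row_trunc k (row k w) &
     tail k <= eps / 12 -> row_trunc k (row k w) < 2 * eps / 3]].

(** Row 0 is good by convention, and a good row followed by a bad one would lie in a failure
    event. *)
Lemma all_goodE : ~` (\bigcup_k bad k) `<=` all_good.
Proof.
move=> w nb; have nbk k : ~ bad k w by move=> h; apply: nb; exists k.
have gk k : good k w.
  elim: k => [|k ih]; first by left.
  right; apply/andP; split; rewrite leNgt; apply/negP => h; apply: (nbk k).
    by left; left; right.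
  by left; left; left.
case=> // k _; split; first exact: gk.
  by move=> h; rewrite leNgt; apply/negP => h2; apply: (nbk k); left; right.
by move=> h; rewrite ltNge; apply/negP => h2; apply: (nbk k); right.
Qed.

Lemma measurable_bad_cup : measurable (\bigcup_k bad k).
Proof. by apply: bigcupT_measurable => k; exact: measurable_bad. Qed.

Lemma prob_bad_cup : prob Pr (\bigcup_k bad k) <= 13 / 16 * alpha.
Proof.
have /andP[a0 a1] := alpha01; have mU := measurable_bad_cup.
rewrite -lee_fin -probE//.
apply: le_trans (measure_sigma_subadditive Pr measurable_bad mU (fun=> id)) _.
apply: (@le_trans _ _ (\big[+%E/0%R]_(0 <= k <oo) (13 / 16 * alpha * 2^-1 ^+ k.+1)%:E)%E).
  apply: lee_nneseries => // k _.
  by have := prob_bad k; rewrite -lee_fin -(probE Pr)//; exact: measurable_bad.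
have b0 k : (0 <= (13 / 16 * alpha * 2^-1 ^+ k.+1)%:E)%E.
  by rewrite lee_fin !mulr_ge0 ?exprn_ge0 ?ltW//; lra.
apply: lime_le; first by apply: is_cvg_nneseries => *; exact: b0.
near=> m; rewrite sumEFin lee_fin -mulr_sumr ler_piMr//; first by lra.
have -> : \sum_(0 <= k < m) 2^-1 ^+ k.+1 = 1 - 2^-1 ^+ m :> R.
  elim: (m) => [|j ih]; first by rewrite big_geq// expr0 subrr.
  by rewrite big_nat_recr//= ih exprS; field.
by rewrite gerBl exprn_ge0.
Unshelve. all: by end_near. Qed.

Lemma prob_gt_of_all_good (A : set T) : measurable A -> all_good `<=` A ->
  ((1 - alpha)%:E < Pr A)%E.
Proof.
have /andP[a0 a1] := alpha01; move=> mA gA; have mU := measurable_bad_cup.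
have mC := measurableC mU.
have := prob_le Pr _ _ mC mA (subset_trans all_goodE gA).
rewrite probC// probE// lte_fin; have := prob_bad_cup; lra.
Qed.

End GoodEvent.

(** * Consequences for a single run *)

Lemma sum_theta_le {R : realType} K :
  \sum_(1 <= k < K.+1) (theta k)%:R <= 2 * (theta K)%:R :> R.
Proof.
elim: K => [|K ih]; first by rewrite big_geq// mulr_ge0.
by rewrite big_nat_recr//= thetaS natrM; lra.
Qed.

Section Run.
Context {R : realType} {n : nat}.
Variables (P : 'M[R]_n) (pi : 'rV[R]_n) (i : 'I_n) (eps alpha Delta : R).
Variable x : nat -> nat -> nat -> 'I_n.
Hypotheses (P_stoch : stochastic P) (P_irr : irreducible P) (pi_stat : stationary P pi).
Hypotheses (eps01 : 0 < eps < 1) (alpha01 : 0 < alpha < 1) (Delta01 : 0 < Delta < 1).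

Local Notation mu k := (mean_trunc P i (theta k)).
Local Notation tail k := (hit_tail P i (theta k) i).
Local Notation That k := (T_hat i eps alpha x k).
Local Notation phat k := (p_hat i eps alpha x k).
Local Notation pihat k := (pi_hat i eps alpha x k).
Local Notation stop k := (stopping_iteration i eps alpha Delta x k).

Lemma num_samples_le k : (0 < k)%N ->
  (num_samples i eps alpha x k.+1)%:R <=
  3 * (1 + eps) * (theta k.+1)%:R * tail_log alpha k.+1 / (That k * eps ^+ 2) + 1.
Proof.
have /andP[e0 e1] := eps01; case: k => // k _.
have L1 := tail_log_ge1 _ alpha01 k.+2 isT.
have T0 : 0 <= That k.+1 by rewrite T_hatE row_mean_ge0.
rewrite num_samplesS /next_size/= -T_hatE.
suff h : 0 <= 3 * (1 + eps) * (theta k.+2)%:R * tail_log alpha k.+2 / (That k.+1 * eps ^+ 2).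
  by have /andP[] := absz_ceil_itv _ h.
apply: divr_ge0; last by rewrite mulr_ge0// ltW// exprn_gt0.
by rewrite !mulr_ge0//; lra.
Qed.

Lemma not_stop_theta_le k : ~ stop k -> (theta k)%:R <= 3 / (eps * Delta).
Proof.
have /andP[e0 e1] := eps01; have /andP[D0 D1] := Delta01.
move=> /not_orP[/negP+ /negP]; rewrite -!leNgt /pi_hat => h1 h2.
have e1p : 0 < 1 + eps by lra.
(* The inverse of 0 is 0, so a zero mean would already meet the first stopping criterion. *)
have T0 : 0 < That k.
  by rewrite -invr_gt0; apply: lt_le_trans h1; rewrite divr_gt0.
have hT : That k * Delta <= 1 + eps.
  by move: h1; rewrite ler_pdivrMr// mulrC ler_pdivlMr// mulrC.
have := row_trunc_le (R := R) k (sample_row i eps alpha x k); rewrite -T_hatE -p_hatE => h3.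
rewrite ler_pdivlMr ?mulr_gt0//.
have th0 : 0 <= (theta k)%:R :> R by [].
have h4 : 2 * eps / 3 * (theta k)%:R * Delta <= That k * Delta.
  by rewrite ler_wpM2r ?(ltW D0)//; apply: le_trans h3; rewrite ler_wpM2r.
by rewrite mulrA; lra.
Qed.

(** Termination is deterministic: the bound on the threshold of an unstopped iteration holds on
    every run. *)
Lemma first_stop : exists K, [/\ (1 <= K)%N, stop K & forall k, (1 <= k < K)%N -> ~ stop k].
Proof.
have ex : exists k, (0 < k)%N && `[< stop k >].
  pose r := 3 / (eps * Delta); exists (Num.bound `|r|).+1; apply/asboolP.
  apply: contrapT => /not_stop_theta_le; rewrite leNgt => /negP; apply.
  apply: le_lt_trans (ler_norm _) _.
  apply: lt_trans (archi_boundP (normr_ge0 r)) _.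
  by rewrite ltr_nat /theta; apply: ltn_trans (ltn_expl _ _) => //; rewrite ltn_exp2l.
exists (ex_minn ex); case: ex_minnP => K /andP[K0 /asboolP sK] Kmin; split => //.
move=> k /andP[k0 kK] sk; have := Kmin k; rewrite k0 asboolT// => /(_ isT).
by rewrite leqNgt kK.
Qed.

Hypothesis run_good : forall k, (0 < k)%N ->
  [/\ (1 - 9 / 10 * eps) * mu k <= That k <= (1 + eps) * mu k,
      eps <= tail k -> 2 * eps / 3 <= phat k &
      tail k <= eps / 12 -> phat k < 2 * eps / 3].

Lemma mu_ge1 k : 1 <= mu k.
Proof. exact: mean_trunc_ge1 P i P_stoch _ (theta_gt0 k). Qed.

Lemma That_gt0 k : (0 < k)%N -> 0 < That k.
Proof.
have /andP[e0 e1] := eps01; have m1 := mu_ge1 k.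
by move=> /run_good[/andP[h _] _ _]; apply: lt_le_trans h; rewrite mulr_gt0; lra.
Qed.

(** Truncation only shortens the mean, [mu k <= 1 / pi 0 i], so the factor [1 + eps] need only cover
    the sampling error. *)
Lemma small_estimate_sound k : (0 < k)%N -> pihat k < Delta / (1 + eps) -> pi 0 i < Delta.
Proof.
move=> k0; have /andP[e0 e1] := eps01; have /andP[D0 D1] := Delta01.
have T0 := That_gt0 k k0; have [/andP[_ Tle] _ _] := run_good k k0.
have p0 := stationary_gt0 P pi P_stoch P_irr pi_stat i.
have pmu := mean_trunc_stationary_le1 P pi P_stoch P_irr pi_stat i (theta k).
have e1p : 0 < 1 + eps by lra.
rewrite /pi_hat ltr_pdivlMr// mulrC ltr_pdivrMr// => h.
have {h Tle} h : 1 + eps < Delta * ((1 + eps) * mu k).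
  by apply: lt_le_trans h _; rewrite ler_pM2l.
have {h} h : 1 < Delta * mu k by rewrite -(ltr_pM2l e1p); lra.
apply: (@lt_le_trans _ _ (pi 0 i * (Delta * mu k))); first by rewrite ltr_pMr.
by rewrite mulrCA ler_piMr ?(ltW D0).
Qed.

Lemma estimate_error_le (W : 'M[R]_n) k : (0 < k)%N ->
  (forall a b, W a i - W b i = fundamental_inv P pi a i - fundamental_inv P pi b i) ->
  phat k < 2 * eps / 3 ->
  `|(pihat k - pi 0 i) / pihat k| <= eps * (2 * Zmax W i + 1).
Proof.
move=> k0 WZ pk; have /andP[e0 e1] := eps01.
have T0 := That_gt0 k k0; have [/andP[Tge Tle] low _] := run_good k k0.
have p0 := stationary_gt0 P pi P_stoch P_irr pi_stat i.
have pmu := mean_trunc_stationary_le1 P pi P_stoch P_irr pi_stat i (theta k).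
have te : tail k <= eps.
  by rewrite leNgt; apply/negP => /ltW /low; rewrite leNgt pk.
have Z0 : 0 <= Zmax W i by apply: le_trans (normr_ge0 (W i i)) (Zmax_ge i W i).
have bias := mean_trunc_bias P pi P_stoch P_irr pi_stat i W _ (theta_gt0 k) WZ.
have {}bias : 1 - pi 0 i * mu k <= 2 * Zmax W i * eps.
  by apply: le_trans bias _; rewrite ler_wpM2l// mulr_ge0.
(* The relative error is [1 - pi T_hat]. Above, it is at most the bias plus [eps]; below,
   [pi mu <= 1] leaves only the sampling error. *)
rewrite /pi_hat mulrBl mulfV ?invr_neq0 ?gt_eqF// invrK.
have h1 : pi 0 i * That k <= (1 + eps) * (pi 0 i * mu k).
  by rewrite [leRHS]mulrCA ler_pM2l.
have h2 : (1 - eps) * (pi 0 i * mu k) <= pi 0 i * That k.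
  rewrite [leLHS]mulrCA ler_pM2l//; apply: le_trans Tge; rewrite ler_wpM2r//; last by lra.
  by apply: le_trans (mu_ge1 k).
have pm0 : 0 <= pi 0 i * mu k by rewrite mulr_ge0 ?ltW//; apply: lt_le_trans (mu_ge1 k).
by rewrite ler_norml; move: (pi 0 i * mu k) (pi 0 i * That k) pmu bias h1 h2 pm0 => a b; nra.
Qed.

Lemma estimate_error_mixing k : (0 < k)%N -> phat k < 2 * eps / 3 ->
  (mixing_time P pi < +oo)%E ->
  exists Z : 'M[R]_n,
    [/\ fundamental_series P pi Z,
        `|(pihat k - pi 0 i) / pihat k| <= eps * (2 * Zmax Z i + 1)
      & ((eps * (2 * Zmax Z i + 1))%:E
           <= eps%:E * ((4 * ln 2)%:E * mixing_time P pi + 1))%E].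
Proof.
have /andP[e0 e1] := eps01.
move=> k0 pk /mixing_timeP[m [m0 -> mm]]; exists (fundamental_sum P pi); split.
- exact: fundamental_sum_series m0 mm.
- by apply: estimate_error_le => // a b; rewrite !mxE; ring.
rewrite -EFinM lee_fin ler_pM2l// lerD2r.
have := Zmax_fundamental_sum_le P pi m P_stoch P_irr pi_stat m0 mm i.
have := @ln2_ge R; have : 0 <= m%:R :> R by [].
by nra.
Qed.

(** The constant is [6 * 40 + 1]: 6 bounds [3 (1 + eps)], 40 the ratio of consecutive estimates, and
    1 pays for the ceiling. *)
Lemma num_steps_le k : (0 < k)%N ->
  num_steps i eps alpha x k <= 241 * ((theta k)%:R * tail_log alpha k) / eps ^+ 2.
Proof.
move=> k0; have /andP[e0 e1] := eps01; have e20 : 0 < eps ^+ 2 by rewrite exprn_gt0.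
have e21 : eps ^+ 2 <= 1 by rewrite exprn_ile1 ?ltW.
have L1 := tail_log_ge1 _ alpha01 k k0; have th0 := thetaR_gt0 (R := R) k.
have Tle : That k <= (theta k)%:R by rewrite T_hatE row_mean_le.
have T0 := That_gt0 k k0; rewrite /num_steps.
have Lth : (theta k)%:R * eps ^+ 2 <= (theta k)%:R * tail_log alpha k.
  by rewrite ler_pM2l//; lra.
rewrite ler_pdivlMr//.
case: k k0 L1 th0 Tle T0 Lth => // -[|k] _ L1 th0 Tle T0 Lth.
  rewrite num_samplesS /next_size/=.
  have -> : ln (8 / alpha) = tail_log alpha 1.
    by rewrite /tail_log /theta expn1; congr (ln (_ / _)); ring.
  have a0 : 0 <= 6 * (1 + eps) * tail_log alpha 1 / eps ^+ 2.
    by rewrite divr_ge0 ?(ltW e20)// !mulr_ge0//; lra.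
  have /andP[_ +] := absz_ceil_itv _ a0; set N := (`|_|%N)%:R => hN.
  have N0 : 0 <= N by [].
  have {}hN : N * eps ^+ 2 <= 6 * (1 + eps) * tail_log alpha 1 + eps ^+ 2.
    apply: (@le_trans _ _ ((6 * (1 + eps) * tail_log alpha 1 / eps ^+ 2 + 1) * eps ^+ 2)).
      by rewrite ler_pM2r.
    by rewrite mulrDl mul1r divfK ?gt_eqF.
  apply: (@le_trans _ _ (N * eps ^+ 2 * (theta 1)%:R)).
    by rewrite mulrAC ler_wpM2l// mulr_ge0// ltW.
  move: hN; rewrite [theta 1]expn1; nra.
have [/andP[+ _] _ _] := run_good k.+1 isT; have [/andP[_ +] _ _] := run_good k.+2 isT.
have T1 := That_gt0 k.+1 isT; have m1 := mu_ge1 k.+1.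
have := mean_trunc_double P i P_stoch (theta k.+1); rewrite -thetaS => hd hT hT1.
(* [2 (1 + eps) / (1 - 9/10 eps)] is at most [2 * 2 * 10]. *)
have T40 : That k.+2 <= 40 * That k.+1 by nra.
have := num_samples_le k.+1 isT; set N := (num_samples _ _ _ _ _)%:R => hN.
have N0 : 0 <= N by [].
have {}hN : N * (That k.+1 * eps ^+ 2) <=
    3 * (1 + eps) * (theta k.+2)%:R * tail_log alpha k.+2 + That k.+1 * eps ^+ 2.
  have Te : 0 < That k.+1 * eps ^+ 2 by rewrite mulr_gt0.
  by move: hN; rewrite -(ler_pM2r Te) mulrDl mul1r divfK ?gt_eqF.
have A0 : 0 < (theta k.+2)%:R * tail_log alpha k.+2 by rewrite mulr_gt0//; lra.
have hA : 3 * (1 + eps) * (theta k.+2)%:R * tail_log alpha k.+2 <=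
    6 * ((theta k.+2)%:R * tail_log alpha k.+2) by nra.
rewrite -(ler_pM2r T1).
apply: (@le_trans _ _ (That k.+2 * (N * (That k.+1 * eps ^+ 2)))).
  by rewrite le_eqVlt; apply/orP; left; apply/eqP; ring.
apply: (@le_trans _ _ (That k.+2 * (6 * ((theta k.+2)%:R * tail_log alpha k.+2) +
    That k.+1 * eps ^+ 2))).
  by rewrite ler_pM2l//; apply: le_trans hN _; rewrite lerD2r.
have h1 : That k.+2 * (6 * ((theta k.+2)%:R * tail_log alpha k.+2)) <=
    40 * That k.+1 * (6 * ((theta k.+2)%:R * tail_log alpha k.+2)).
  by rewrite ler_pM2r// mulr_gt0.
have h2 : That k.+2 * eps ^+ 2 <= (theta k.+2)%:R * tail_log alpha k.+2.
  by apply: le_trans Lth; rewrite ler_pM2r.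
have := ler_wpM2l (ltW T1) h2; lra.
Qed.

(** All logarithms are raised to the last one, and the geometric sum of thresholds doubles 241. *)
Lemma sum_num_steps_le K : (0 < K)%N ->
  \sum_(1 <= k < K.+1) num_steps i eps alpha x k <=
  482 * ((theta K)%:R * tail_log alpha K) / eps ^+ 2.
Proof.
have /andP[e0 e1] := eps01; have /andP[a0 a1] := alpha01.
have e20 : 0 < eps ^+ 2 by rewrite exprn_gt0.
case: K => // K _.
apply: (@le_trans _ _ (\sum_(1 <= k < K.+2)
    241 * ((theta k)%:R * tail_log alpha K.+1) / eps ^+ 2)).
  rewrite !big_nat; apply: ler_sum => k /andP[k0 kK].
  apply: le_trans (num_steps_le k k0) _.
  rewrite ler_pM2r ?invr_gt0// ler_pM2l ?ltr0n// ler_pM2l ?thetaR_gt0//.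
  have t0 := thetaR_gt0 (R := R); rewrite /tail_log ler_ln ?posrE ?divr_gt0 ?mulr_gt0//.
  by rewrite ler_pM2r ?invr_gt0// ler_pM2l// ler_nat leq_exp2l.
rewrite -mulr_suml -mulr_sumr -mulr_suml ler_pM2r ?invr_gt0// mulrA.
have := sum_theta_le (R := R) K.+1.
have := tail_log_ge1 _ alpha01 K.+1 isT.
by move: (\sum_(_ <= _ < _) _) (theta K.+1)%:R (tail_log _ _) => a b c; nra.
Qed.

(* Truncation halves within [2 H] steps, so a run that has not stopped has
   threshold [O (H log (1 / eps))]. *)
Lemma stop_theta_le (h : R) K : 1 <= h ->
  (forall m y, \sum_(0 <= t < m) hit_tail P i t y <= h) ->
  (1 <= K)%N -> (forall k, (1 <= k < K)%N -> ~ stop k) ->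
  (theta K)%:R <= 18 * ln (12 / eps) * Num.min h (1 / (eps * Delta)).
Proof.
have /andP[e0 e1] := eps01; have /andP[D0 D1] := Delta01.
move=> h1 hh K1 hK; set Lam := ln (12 / eps); set r := 1 / (eps * Delta).
have l2 := @ln2_ge R.
have Lam1 : 1 <= Lam.
  have : ln (2 ^+ 3) <= Lam.
    by rewrite ler_ln ?posrE ?divr_gt0 ?exprn_gt0// ler_pdivlMr//; nra.
  by rewrite lnXn//; lra.
have r1 : 1 <= r by rewrite /r ler_pdivlMr ?mulr_gt0//; nra.
(* Iteration [K - 1] did not stop, and its threshold is half as large. So 6 is [2 * 3], and 18 is
   [2 * 3 * 3], from a block length [m <= 3 h] and a number of blocks at most [3 Lam]. *)
suff [hA hB] : (theta K)%:R <= 18 * Lam * h /\ (theta K)%:R <= 6 * r.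
  case: (leP h r) => _ //; apply: le_trans hB _; nra.
case: K K1 hK => // -[|K] _ hK.
  by rewrite [theta 1]expn1; split; nra.
have ns : ~ stop K.+1 by apply: hK; rewrite ltnSn.
have hr := not_stop_theta_le _ ns.
rewrite thetaS natrM; split; last first.
  by rewrite /r; move: hr; rewrite -[X in X / _]mulr1 -mulrA; lra.
have tl : eps / 12 < tail K.+1.
  rewrite ltNge; apply/negP => /(let: And3 _ _ h3 := run_good K.+1 isT in h3) hp.
  by apply: ns; right.
have h20 : 0 <= 2 * h by lra.
have := absz_ceil_itv _ h20; set m := `|_|%N => /andP[m1 m2].
have m0 : (0 < m)%N by rewrite -(ltr_nat R); lra.
have half y : hit_tail P i m y <= 2^-1.
  have := partial_sum_hit_tail_le P i P_stoch h m y (hh m y) => hm.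
  have := hit_tail_ge0 P i P_stoch m y; nra.
pose l := (theta K.+1 %/ m)%N.
have tl2 : eps / 12 < 2^-1 ^+ l.
  apply: lt_le_trans tl (le_trans _ (hit_tail_halving P i P_stoch m l half i)).
  by apply: hit_tail_le => //; rewrite leq_divM.
have hl : l%:R <= 2 * Lam.
  have : ln (2 ^+ l) <= Lam.
    rewrite ler_ln ?posrE ?divr_gt0 ?exprn_gt0//.
    rewrite -[leLHS]invrK -exprVn -[leRHS]invrK lef_pV2 ?posrE ?invr_gt0 ?divr_gt0 ?exprn_gt0 ?invr_gt0//.
    by rewrite invf_div ltW.
  rewrite lnXn// -[ln 2 *+ l]mulr_natl => hLam; have lp : 0 <= l%:R :> R by [].
  by have := ler_wpM2l lp l2; lra.
have : (theta K.+1)%:R <= (l%:R + 1) * m%:R :> R.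
  by rewrite natr1 -natrM ler_nat ltnW// ltn_ceil.
have l0 : 0 <= l%:R :> R by [].
have : (l%:R + 1) * m%:R <= 3 * Lam * (3 * h).
  by apply: ler_pM => //; lra.
lra.
Qed.

End Run.

(** * Soft-O comparisons *)

Lemma polylog_ge1 {R : realType} (g : R) : 0 <= g -> 1 <= 1 + ln (1 + g).
Proof. by move=> g0; rewrite lerDl ln_ge0// lerDl. Qed.

(** Lets the polylogarithm of [f = a / eps^2] absorb [log (1 / eps)]. The lower bound on [a] gives
    [1 / eps <= M f]. *)
Lemma log_inv_eps_le {R : realType} (eps a : R) (M : nat) :
  0 < eps < 1 -> 0 < a -> 1 <= M%:R * a ->
  ln (12 / eps) <= (11 + M%:R) * (1 + ln (1 + a / eps ^+ 2)).
Proof.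
move=> /andP[e0 e1] a0 Ma; set f := a / eps ^+ 2.
have f0 : 0 <= f by rewrite divr_ge0 ?exprn_ge0 ?(ltW a0) ?(ltW e0).
have F0 : 0 <= ln (1 + f) by rewrite ln_ge0// lerDl.
have -> : ln (12 / eps) = ln (1 + 11) + ln (1 / eps) :> R.
  rewrite -lnM ?posrE ?divr_gt0//; congr ln; rewrite mul1r; congr (_ / _); ring.
have h1 : ln (1 + 11) <= 11 :> R by apply: le_ln1Dx; lra.
have e20 : 0 < eps ^+ 2 by rewrite exprn_gt0.
have h2 : ln (1 / eps) <= ln (1 + M%:R * f).
  have Mf0 : 0 <= M%:R * f by rewrite mulr_ge0.
  rewrite ler_ln ?posrE ?divr_gt0//; last by lra.
  apply: (@le_trans _ _ (1 / eps ^+ 2)).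
    by rewrite !div1r lef_pV2 ?posrE//; nra.
  rewrite /f mulrA; apply: (@le_trans _ _ (M%:R * a / eps ^+ 2)); last by rewrite lerDr.
  by rewrite ler_pM2r ?invr_gt0.
have h3 := ln1D_mul_le R M f f0.
have M0 : 0 <= M%:R :> R by [].
nra.
Qed.

(** The exponent 2 counts two factors [log (1 / eps)], one from the threshold and one from the
    logarithm in the sample size. *)
Lemma steps_le_soft_O {R : realType} (S c0 : R) (M : nat) :
  0 <= S -> 0 < c0 -> 1 <= M%:R * c0 ->
  exists C : R, 0 <= C /\ forall (eps alpha a th g : R), 0 < eps < 1 -> 0 < alpha ->
    a = ln (1 / alpha) -> c0 <= a -> 1 <= g -> 0 < th ->
    th <= 18 * ln (12 / eps) * g ->
    S * (th * ln (4 * th / alpha)) / eps ^+ 2 <= soft_O_bound C 2 (a / eps ^+ 2) g.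
Proof.
(* [K] turns the sum [72 + Lam + G + a] into the product [a Lam G]: [Lam] and [G] are at least 1,
   [a] is at least [c0], and [72 + 1 + 1 = 74]. *)
move=> S0 c00 Mc; pose K := 74 / c0 + 1; pose B : R := 11 + M%:R.
exists (S * 18 * K * B ^+ 2).
have M0 : 0 <= M%:R :> R by [].
have K0 : 0 <= K by rewrite addr_ge0 ?divr_ge0 ?ler0n ?ler01 ?(ltW c00).
have B0 : 0 <= B by rewrite addr_ge0 ?ler0n.
have S18 : 0 <= S * 18 by rewrite mulr_ge0 ?ler0n.
have SKB : 0 <= S * 18 * K by rewrite mulr_ge0.
split; first by rewrite mulr_ge0 ?exprn_ge0.
move=> eps alpha a th g eps01 al0 aE ca g1 th0 thle.
have /andP[e0 e1] := eps01; have e20 : 0 < eps ^+ 2 by rewrite exprn_gt0.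
have a0 : 0 < a by apply: lt_le_trans ca.
have Ma : 1 <= M%:R * a by apply: le_trans Mc _; rewrite ler_wpM2l.
have hLam := log_inv_eps_le eps a M eps01 a0 Ma.
rewrite /soft_O_bound; set f := a / eps ^+ 2 in hLam *.
set F := 1 + ln (1 + f) in hLam *; set G := 1 + ln (1 + g).
have f0 : 0 <= f by rewrite divr_ge0 ?(ltW a0) ?(ltW e20).
have F1 : 1 <= F by exact: polylog_ge1.
have G1 : 1 <= G by apply: polylog_ge1; lra.
set Lam := ln (12 / eps) in thle hLam *.
have Lam1 : 1 <= Lam.
  have := @ln2_ge R; have : ln (2 ^+ 2) <= Lam.
    by rewrite ler_ln ?posrE ?divr_gt0 ?exprn_gt0// ler_pdivlMr//; nra.
  by rewrite lnXn//; lra.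
have hlog : ln (4 * th / alpha) <= 72 + Lam + G + a.
  have Lg : 0 < Lam * g by rewrite mulr_gt0; lra.
  rewrite aE (_ : 4 * th / alpha = 4 * th * (1 / alpha)) ?mul1r//.
  rewrite lnM ?posrE ?mulr_gt0 ?invr_gt0// lerD2r.
  have : ln (4 * th) <= ln (72 * (Lam * g)).
    by rewrite ler_ln ?posrE ?mulr_gt0//; lra.
  have -> : ln (72 * (Lam * g)) = ln 72 + (ln Lam + ln g).
    by rewrite !lnM ?posrE//; lra.
  have : ln (1 + 71) <= 71 :> R by apply: le_ln1Dx; lra.
  have -> : 1 + 71 = 72 :> R by ring.
  have : ln (1 + (Lam - 1)) <= Lam - 1 by apply: le_ln1Dx; lra.
  have -> : 1 + (Lam - 1) = Lam by ring.
  have : ln g <= ln (1 + g) by rewrite ler_ln ?posrE; lra.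
  by rewrite /G; lra.
have hlog2 : ln (4 * th / alpha) <= a * K * (Lam * G).
  have LG : 1 <= Lam * G by rewrite -[leLHS]mulr1 ler_pM.
  have ac : 1 <= a / c0 by rewrite ler_pdivlMr// mul1r.
  apply: le_trans hlog _.
  have -> : a * K * (Lam * G) = (a / c0) * (74 * (Lam * G)) + a * (Lam * G).
    by rewrite /K; ring.
  have h1 : 74 * (Lam * G) <= (a / c0) * (74 * (Lam * G)) by rewrite ler_peMl//; lra.
  have h2 : a <= a * (Lam * G) by rewrite ler_peMr// ltW.
  have h3 : Lam <= Lam * G by rewrite ler_peMr//; lra.
  have h4 : G <= Lam * G by rewrite ler_peMl//; lra.
  lra.
have aK : 0 <= a * K by rewrite mulr_ge0// ltW.
have g0 : 0 <= g by lra. have Lam0 : 0 <= Lam by lra. have G0 : 0 <= G by lra.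
apply: (@le_trans _ _ (S * (18 * Lam * g * (a * K * (Lam * G))) / eps ^+ 2)).
  rewrite ler_pM2r ?invr_gt0//; apply: ler_wpM2l => //.
  apply: (@le_trans _ _ (th * (a * K * (Lam * G)))).
    by rewrite ler_pM2l.
  by apply: ler_wpM2r => //; exact: (mulr_ge0 aK (mulr_ge0 Lam0 G0)).
rewrite [leLHS](_ : _ = S * 18 * K * f * g * (Lam ^+ 2 * G)); last first.
  by rewrite /f; ring.
rewrite [leRHS](_ : _ = S * 18 * K * f * g * ((B * F) ^+ 2 * G ^+ 2)); last first.
  by rewrite /B; ring.
apply: ler_wpM2l; first by apply: mulr_ge0 => //; apply: mulr_ge0.
apply: ler_pM => //; first exact: exprn_ge0.
  by rewrite lerXn2r ?nnegrE// /B; apply: le_trans hLam.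
by rewrite expr2 ler_peMr.
Qed.

(** A factor 3 comes from [g] itself and a factor 3 from each of the two logarithms, hence 27. *)
Lemma soft_O_bound_scale {R : realType} (C f g1 g2 : R) : 0 <= C -> 0 <= f ->
  0 <= g1 <= 3 * g2 ->
  soft_O_bound C 2 f g1 <= soft_O_bound (27 * C) 2 f g2.
Proof.
move=> C0 f0 /andP[g10 g12]; have g20 : 0 <= g2 by lra.
rewrite /soft_O_bound; set F := f * _.
have F0 : 0 <= F by rewrite mulr_ge0// exprn_ge0// addr_ge0// ln_ge0// lerDl.
rewrite [leRHS](_ : _ = C * F * (3 * g2 * (3 * (1 + ln (1 + g2))) ^+ 2)); last by ring.
have G0 : 0 <= ln (1 + g2) by rewrite ln_ge0// lerDl.
have h1 : 0 <= ln (1 + g1) by rewrite ln_ge0// lerDl.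
apply: ler_wpM2l; first exact: mulr_ge0.
apply: ler_pM => //; first by rewrite exprn_ge0//; lra.
rewrite lerXn2r ?nnegrE//; try by lra.
have := ln1D_mul_le R 3 g2 g20.
have : ln (1 + g1) <= ln (1 + 3 * g2) by rewrite ler_ln ?posrE; lra.
lra.
Qed.

(** * Comparison of hitting and mixing times *)

Section Hitting.
Context {R : realType} {n : nat}.
Variables (P : 'M[R]_n) (pi : 'rV[R]_n) (i : 'I_n).
Hypotheses (P_stoch : stochastic P) (P_irr : irreducible P) (pi_stat : stationary P pi).

(** Off [i] the constant is [2 * 11/8], at most 3; at [i] Kac's formula and [m >= 1] suffice. *)
Lemma mean_hit_le_mixing (m : nat) : (0 < m)%N ->
  \big[Num.max/0]_(x < n) tv_dist (row x (P ^+ m)) pi <= 4^-1 ->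
  forall x, mean_hit P pi i x <= 3 * (m%:R / pi 0 i).
Proof.
move=> m0 mm x; have p0 := stationary_gt0 P pi P_stoch P_irr pi_stat i.
have m1 : 1 <= m%:R :> R by rewrite ler1n.
have [->|xi] := eqVneq x i.
  rewrite mean_hit_return mulrA -[leLHS]mul1r ler_pM2r ?invr_gt0//; lra.
apply: le_trans (mean_hit_le_Zmax P pi P_stoch P_irr pi_stat i (fundamental_sum P pi) _ x xi) _.
  by move=> a b; rewrite !mxE; ring.
rewrite mulrA ler_pM2r ?invr_gt0//.
by have := Zmax_fundamental_sum_le P pi m P_stoch P_irr pi_stat m0 mm i; lra.
Qed.

Lemma hitting_mixing_min_le (h r : R) : 0 <= h -> 0 <= r ->
  (forall B, (forall x, mean_hit P pi i x <= B) -> h <= B) ->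
  0 <= fine (mine h%:E r%:E) <=
    3 * fine (mine (mixing_time P pi * ((pi 0 i)^-1)%:E)%E r%:E).
Proof.
move=> h0 r0 hB; have p0 := stationary_gt0 P pi P_stoch P_irr pi_stat i.
rewrite -EFin_min /=; apply/andP; split; first by rewrite le_min h0.
have [/mixing_timeP[m [m0 -> mm]]|] := ltP (mixing_time P pi) +oo%E.
  rewrite -EFinM -EFin_min/=; have := hB _ (mean_hit_le_mixing m m0 mm).
  have : 0 <= m%:R / pi 0 i by rewrite divr_ge0// ltW.
  move: (m%:R / pi 0 i) => u u0 hu.
  by rewrite /Num.min; case: ltP => ?; case: ltP => ?; lra.
(* With an infinite mixing time the minimum on the right is [r], which bounds the left one too. *)
rewrite leye_eq => /eqP ->; rewrite mulyr gtr0_sg ?invr_gt0// mul1e.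
by rewrite minye/= /Num.min; case: ltP => ?; lra.
Qed.

End Hitting.

(** * Measurability of the event and assembly of the theorem *)

Lemma dmeas_and3 {T : Type} (S : set (set T)) (p q r : T -> Prop) : sigma_algebra setT S ->
  dmeas S p -> dmeas S q -> dmeas S r -> dmeas S (fun w => [/\ p w, q w & r w]).
Proof.
move=> hS mp mq mr.
have -> : (fun w => [/\ p w, q w & r w]) = fun w => p w /\ (q w /\ r w).
  by apply/funext => w; apply/propext; split=> [[]|[? []]].
by apply: dmeas_and => //; exact: dmeas_and.
Qed.

Lemma dmeas_and4 {T : Type} (S : set (set T)) (p q r s : T -> Prop) : sigma_algebra setT S ->
  dmeas S p -> dmeas S q -> dmeas S r -> dmeas S s ->
  dmeas S (fun w => [/\ p w, q w, r w & s w]).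
Proof.
move=> hS mp mq mr ms.
have -> : (fun w => [/\ p w, q w, r w & s w]) = fun w => p w /\ [/\ q w, r w & s w].
  by apply/funext => w; apply/propext; split=> [[]|[? []]].
by apply: dmeas_and => //; exact: dmeas_and3.
Qed.

Section EstimateMeasurability.
Context {d : measure_display} {T : measurableType d} {R : realType} {n : nat}.
Variables (Pr : probability T R) (P : 'M[R]_n) (i : 'I_n) (eps alpha : R).
Variable X : nat -> nat -> nat -> T -> 'I_n.
Hypothesis X_chain : forall k s, markov_chain Pr P i (X k s).

Local Notation path w := (fun k s t => X k s t w).

(** The two estimates are taken jointly because the stopping rule involves both; the pair factors
    through the countably valued row. *)
Lemma dmeas_estimates k : dmeas measurable
  (fun w => (pi_hat i eps alpha (path w) k, p_hat i eps alpha (path w) k)).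
Proof.
rewrite (_ : (fun w => _) = fun w => (fun r : seq nat => ((row_mean k r)^-1, row_trunc k r))
    (sample_row i eps alpha (path w) k)); last first.
  by apply/funext => w; rewrite /pi_hat T_hatE p_hatE.
exact: (dmeas_comp measurable (fun r : seq nat => ((row_mean k r)^-1, row_trunc k r) : R * R) _
  (dmeas_row Pr P i eps alpha X X_chain k)).
Qed.

Lemma dmeas_sum_steps K : dmeas measurable
  (fun w => \sum_(1 <= k < K.+1) num_steps i eps alpha (path w) k).
Proof.
pose g (r : nat * seq nat) : R := (size r.2)%:R * row_mean r.1 r.2.
rewrite (_ : (fun w => _) = fun w => (fun u : seq (nat * seq nat) => \sum_(r <- u) g r)
   [seq (k, sample_row i eps alpha (path w) k) | k <- iota 1 K]); last first.
  apply/funext => w; rewrite /= big_map /index_iota subSS subn0.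
  by apply: eq_bigr => k _; rewrite /g/= size_sample_row /num_steps T_hatE.
apply: (dmeas_comp measurable (fun u => \sum_(r <- u) g r)
  (fun w => [seq (k, sample_row i eps alpha (path w) k) | k <- iota 1 K])).
apply: (dmeas_map measurable (sigma_algebra_measurable T)
  (fun k w => (k, sample_row i eps alpha (path w) k))) => k.
exact: (dmeas_comp measurable (pair k) _ (dmeas_row Pr P i eps alpha X X_chain k)).
Qed.

End EstimateMeasurability.

(** The constants depend on [alpha0] because [ln (1 / alpha)] tends to 0 as [alpha] tends to 1,
    while the algorithm still takes samples. *)
Theorem theorem3 (R : realType) (alpha0 : R) (halpha0 : 0 < alpha0 < 1) :
  exists (C1 C2 : R) (c1 c2 : nat),
  forall (n : nat) (P : 'M[R]_n) (pi : 'rV[R]_n) (i : 'I_n)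
    (eps alpha Delta : R)
    (d : measure_display) (T : measurableType d) (Pr : probability T R)
    (X : nat -> nat -> nat -> T -> 'I_n)
    (d' : measure_display) (T' : measurableType d') (Pr' : probability T' R)
    (Y : 'I_n -> nat -> T' -> 'I_n),
  stochastic P -> irreducible P -> stationary P pi ->
  0 < eps < 1 -> 0 < alpha <= alpha0 -> 0 < Delta < 1 ->
  (forall k s, markov_chain Pr P i (X k s)) ->
  independent_processes Pr (fun ks : nat * nat => X ks.1 ks.2) ->
  (forall j, markov_chain Pr' P j (Y j)) ->
  let H := max_hitting_time Pr' Y i in
  let tmix := mixing_time P pi in
  let good := [set w : T |
    let x := fun k s t => X k s t w in
    let pih := pi_hat i eps alpha x in
    let ph := p_hat i eps alpha x in
    [/\ (* (a) *)
        (forall k : nat, (1 <= k)%N ->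
           pih k < Delta / (1 + eps) -> pi 0 i < Delta),
        (* (b) *)
        (forall k : nat, (1 <= k)%N -> ph k < 2 * eps / 3 ->
           let err := `|(pih k - pi 0 i) / pih k| in
           err <= eps * (2 * Zmax (fundamental_inv P pi) i + 1) /\
           ((tmix < +oo)%E ->
            exists Z : 'M[R]_n,
              [/\ fundamental_series P pi Z,
                  err <= eps * (2 * Zmax Z i + 1)
                & ((eps * (2 * Zmax Z i + 1))%:E
                     <= eps%:E * ((4 * ln 2)%:E * tmix + 1))%E]))
      & (* (c) *)
        exists K : nat,
          [/\ (1 <= K)%N,
              stopping_iteration i eps alpha Delta x K,
              forall k : nat, (1 <= k < K)%N ->
                ~ stopping_iteration i eps alpha Delta x k
            & let f := ln (1 / alpha) / eps ^+ 2 in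
              let g1 := fine (mine H (1 / (eps * Delta))%:E) in
              let g2 := fine (mine (tmix * ((pi 0 i)^-1)%:E)%E
                                   (1 / (eps * Delta))%:E) in
              \sum_(1 <= k < K.+1) num_steps i eps alpha x k
                <= soft_O_bound C1 c1 f g1
                <= soft_O_bound C2 c2 f g2]]] in
  measurable good /\ ((1 - alpha)%:E < Pr good)%E.
Proof.
have /andP[a00 a01] := halpha0.
pose c0 := ln (1 / alpha0) : R.
have c00 : 0 < c0 by rewrite ln_gt0// ltr_pdivlMr// mul1r.
(* A natural number, since [ln (1 + M f) <= M ln (1 + f)] comes from Bernoulli's inequality for
   powers. *)
pose M := (Num.bound `|c0^-1|).
have Mc : 1 <= M%:R * c0.
  rewrite -ler_pdivrMr// div1r; apply/ltW.
  exact: le_lt_trans (ler_norm _) (archi_boundP (normr_ge0 _)).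
have S0 : 0 <= 482 :> R by exact: ler0n.
have [C [C0 HC]] := steps_le_soft_O 482 c0 M S0 c00 Mc.
exists C, (27 * C), 2%N, 2%N.
move=> n P pi i eps alpha Delta d T Pr X d' T' Pr' Y P_stoch P_irr pi_stat eps01.
move=> /andP[al0 ala] Delta01 X_chain X_indep Y_chain H tmix good.
have alpha01 : 0 < alpha < 1 by rewrite al0; apply: le_lt_trans a01.
have /andP[e0 e1] := eps01; have /andP[D0 D1] := Delta01.
have sigmaT := sigma_algebra_measurable T.
have est := dmeas_estimates Pr P i eps alpha X X_chain.
(* Each clause is a countable combination of conditions on the estimates or on sums of step counts;
   the remaining quantities do not depend on the run. *)
have mgood : measurable good.
  pose estp k (q : R * R -> Prop) := dmeas_comp measurable q _ (est k).
  apply: dmeas_set; apply: dmeas_and3 => //.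
  - apply: dmeas_forall => // k; apply: dmeas_imp => //.
    exact: (estp k (fun u => u.1 < Delta / (1 + eps) -> pi 0 i < Delta)).
  - apply: dmeas_forall => // k; apply: dmeas_imp => //.
    exact: (estp k (fun u => u.2 < 2 * eps / 3 ->
      let err := `|(u.1 - pi 0 i) / u.1| in
      err <= eps * (2 * Zmax (fundamental_inv P pi) i + 1) /\
      ((tmix < +oo)%E ->
         exists Z : 'M[R]_n,
           [/\ fundamental_series P pi Z, err <= eps * (2 * Zmax Z i + 1)
             & ((eps * (2 * Zmax Z i + 1))%:E
                  <= eps%:E * ((4 * ln 2)%:E * tmix + 1))%E]))).
  - pose stopp (u : R * R) : Prop := u.1 < Delta / (1 + eps) \/ u.2 < 2 * eps / 3.
    apply: dmeas_exists => // K; apply: dmeas_and4 => //.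
    + exact: dmeas_cst.
    + exact: (estp K stopp).
    + by apply: dmeas_forall => // k; apply: dmeas_imp => //; exact: (estp k (fun u => ~ stopp u)).
    + exact: (dmeas_comp measurable (fun u : R => u <= _ <= _) _
        (dmeas_sum_steps Pr P i eps alpha X X_chain K)).
split => //; apply: (prob_gt_of_all_good Pr P i eps alpha X) => // w hw.
have run_good k : (0 < k)%N ->
  [/\ (1 - 9 / 10 * eps) * mean_trunc P i (theta k) <=
        T_hat i eps alpha (fun k s t => X k s t w) k <= (1 + eps) * mean_trunc P i (theta k),
      eps <= hit_tail P i (theta k) i -> 2 * eps / 3 <= p_hat i eps alpha (fun k s t => X k s t w) k &
      hit_tail P i (theta k) i <= eps / 12 -> p_hat i eps alpha (fun k s t => X k s t w) k < 2 * eps / 3].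
  move=> k0; have [[k0'|gk] lo hi] := hw k k0; first by rewrite k0' in k0.
  by rewrite T_hatE p_hatE.
split.
- by move=> k k1; exact: (small_estimate_sound P pi i eps alpha Delta _).
- move=> k k1 pk err; split; first exact: (estimate_error_le P pi i eps alpha _).
  exact: (estimate_error_mixing P pi i eps alpha _).
have [K [K1 sK nK]] := first_stop i eps alpha Delta (fun k s t => X k s t w) eps01 Delta01.
exists K; split=> //.
have [h [HE h1 hsum hB]] := max_hitting_time_spec Pr' P pi i Y P_stoch P_irr pi_stat Y_chain.
move=> f g1 g2.
have r0 : 0 <= 1 / (eps * Delta) by rewrite divr_ge0// mulr_ge0// ltW.
have g12 : 0 <= g1 <= 3 * g2.
  rewrite /g1 /g2 /H HE.
  exact: (hitting_mixing_min_le P pi i P_stoch P_irr pi_stat h _ (le_trans ler01 h1) r0 hB).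
have ca : c0 <= ln (1 / alpha).
  by rewrite ler_ln ?posrE ?divr_gt0// !div1r lef_pV2 ?posrE.
have f0 : 0 <= f by rewrite divr_ge0 ?exprn_ge0 ?(ltW e0)//; apply: le_trans ca; exact: ltW.
apply/andP; split; last exact: soft_O_bound_scale.
have g1E : g1 = Num.min h (1 / (eps * Delta)) by rewrite /g1 /H HE -EFin_min.
apply: le_trans (sum_num_steps_le P i eps alpha _ _ _ _ run_good K K1) _ => //.
rewrite /f; apply: (HC _ alpha) => //.
- rewrite g1E le_min h1/= ler_pdivlMr ?mulr_gt0// mul1r; nra.
- by rewrite thetaR_gt0.
- rewrite g1E; exact: (stop_theta_le P i eps alpha Delta _ P_stoch eps01 Delta01 run_good).
Qed.
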